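(* For any outerplanar graph $G$ with maximum degree $3$, $\chi_{vi,2}(G)\leq 6$.
   Context: All graphs are finite, simple and undirected. An incidence of $G$ is a pair $(v,e)$ with $v\in V(G)$, $e\in E(G)$, $v\in e$; $I(G)$ is the set of incidences. Let $G^{1/3}$ be obtained from $G$ by replacing each edge $e=\{u,v\}$ by the path $u,(u,e),(v,e),v$. A $vi$-simultaneous proper $k$-coloring of $G$ is a map $c:V(G)\cup I(G)\to\{1,\dots,k\}$ such that any two distinct elements at distance at most $3$ in $G^{1/3}$ receive distinct colors. For a vertex $v$, $I_2(v)=\{(u,\{u,v\}) : u\in N_G(v)\}$. Such a coloring is a $(k,s)$-coloring if for every vertex $v$ at most $s$ distinct colors appear on $I_2(v)$; $\chi_{vi,s}(G)$ is the least such $k$. A graph is outerplanar if it has a planar drawing with all vertices on the outer face. *)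

(* Defs.v *)
From HB Require Import structures.
From mathcomp Require Import all_boot all_order all_algebra.
From mathcomp Require Import all_classical all_reals all_analysis.

Set Implicit Arguments.
Unset Strict Implicit.
Unset Printing Implicit Defensive.

Import Order.TTheory GRing.Theory Num.Theory.
Import numFieldNormedType.Exports.

Record sgraph := SGraph {
  vertex :> finType;
  adj : rel vertex;
  adj_sym : symmetric adj;
  adj_irr : irreflexive adj }.

Arguments adj {s} x y.

Section Graphs.
Variable G : sgraph.

Definition edges : {set {set G}} :=
  [set e | [exists u, exists v, adj u v && (e == [set u; v]%SET)]]%SET.

Definition neighbours (v : G) : {set G} := [set u | adj v u]%SET.

Definition max_degree : nat := (\max_(v : G) #|neighbours v|)%N.

Definition dist_le (n : nat) (x y : G) : Prop :=
  exists p : seq G, [/\ path adj x p, last x p = y & (size p <= n)%N].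

End Graphs.

Section Incidences.
Variable G : sgraph.

Definition incidence : finType :=
  {i : G * {set G} | (i.2 \in edges G) && (i.1 \in i.2)}.

Definition inc_vertex (i : incidence) : G := (val i).1.
Definition inc_edge (i : incidence) : {set G} := (val i).2.

Definition third_adj (x y : G + incidence) : bool :=
  match x, y with
  | inl _, inl _ => false
  | inl u, inr i => inc_vertex i == u
  | inr i, inl u => inc_vertex i == u
  | inr i, inr j => (inc_edge i == inc_edge j) && (inc_vertex i != inc_vertex j)
  end.

Lemma third_adj_sym : symmetric third_adj.
Proof.
move=> [u|i] [v|j] //=.
by rewrite eq_sym [inc_vertex i == _]eq_sym.
Qed.

Lemma third_adj_irr : irreflexive third_adj.
Proof. by move=> [u|i] //=; rewrite !eqxx. Qed.

(* The graph G^{1/3}, with vertex set V(G) + I(G). *)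
Definition third_subdivision : sgraph := SGraph third_adj_sym third_adj_irr.

Definition I2 (v : G) : {set incidence} :=
  [set i | (inc_vertex i \in neighbours v) &&
           (inc_edge i == [set inc_vertex i; v]%SET)]%SET.

Definition vi_proper (C : eqType) (c : G + incidence -> C) : Prop :=
  forall x y : third_subdivision, x != y -> dist_le 3 x y -> c x != c y.

Definition ks_coloring (k s : nat) (c : G + incidence -> 'I_k) : Prop :=
  vi_proper c /\
  forall v : G, (#|[set c (inr i) | i in I2 v]%SET| <= s)%N.

Definition ks_colorable (s k : nat) : Prop :=
  exists c : G + incidence -> 'I_k, ks_coloring s c.

(* For s > 0 some k always works: use one private colour for each vertex and
   one for each set I2 v, so that the minimum chi_vi below is well defined. *)
Lemma ks_colorable_ex (s : nat) : (0 < s)%N ->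
  exists k, `[< ks_colorable s k >].
Proof.
move=> s0.
pose f (x : G + incidence) : (G + {set G})%type :=
  match x with inl v => inl v | inr i => inr (inc_edge i :\ inc_vertex i)%SET end.
exists #|{: G + {set G}}|; apply/asboolP.
exists (fun x => enum_rank (f x)); split.
- move=> x y xy [p [xp lp sp]]; apply/negP => /eqP /enum_rank_inj.
  case: x y xy xp lp => [u|i] [v|j] //= xy xp lp.
    by case=> uv; rewrite uv eqxx in xy.
  case=> ij.
  have vij : inc_vertex i <> inc_vertex j.
    move=> eqv; case/eqP: xy; congr inr; apply: val_inj.
    have ini : inc_vertex i \in inc_edge i by case/andP: (valP i).
    have inj : inc_vertex j \in inc_edge j by case/andP: (valP j).
    have eqe : inc_edge i = inc_edge j.
      by rewrite -(finset.setD1K ini) -(finset.setD1K inj) ij eqv.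
    by move: eqv eqe; rewrite /inc_vertex /inc_edge;
       case: (val i) (val j) => [a b] [a' b'] /= -> ->.
  have eij : inc_edge i <> inc_edge j.
    move=> eqe; have ini : inc_vertex i \in inc_edge i by case/andP: (valP i).
    have : inc_vertex i \in (inc_edge i :\ inc_vertex i)%SET.
      by rewrite ij !inE -eqe ini andbT; apply/eqP.
    by rewrite !inE eqxx.
  have notin (l l' : incidence) : third_adj (inr l) (inr l') ->
      inc_vertex l' \in (inc_edge l :\ inc_vertex l)%SET.
    case/andP=> /eqP ee nv; rewrite !inE eq_sym nv ee /=.
    by case/andP: (valP l').
  have edgeP (l : incidence) (a b : G) :
      a \in (inc_edge l :\ inc_vertex l)%SET ->
      b \in (inc_edge l :\ inc_vertex l)%SET -> a = b.
    have /andP[+ lin] := valP l.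
    rewrite inE => /existsP[u /existsP[v /andP[_ /eqP el]]].
    rewrite /inc_edge /inc_vertex.
    move: lin; rewrite el !inE.
    by case/orP=> /eqP-> /andP[/negPf na] + /andP[/negPf nb];
       rewrite na nb ?orbF /= => /eqP-> /eqP->.
  case: p xp lp sp => [|m1 [|m2 [|m3 [|? ?]]]] //=.
  + by move=> _ [ij'] _; case: vij; rewrite ij'.
  + rewrite andbT => + m1j _; rewrite m1j /= => /andP[/eqP ee _].
    by case: eij.
  + rewrite andbT => /andP[+ +] m2j _; rewrite m2j.
    case: m1 => [a|l] /= => [/eqP ia /eqP ja|/andP[/eqP il _] /andP[/eqP lj _]].
      by case: vij; rewrite ia ja.
    by case: eij; rewrite il.
  + rewrite andbT => /and3P[h1 h2 h3] m3j _; move: h3; rewrite m3j => h3.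
    case: m1 h1 h2 => [a|l] h1 h2; case: m2 h2 h3 => [b|l'] h2 h3 //.
    * have jv : inc_vertex l' \in (inc_edge j :\ inc_vertex j)%SET.
        by apply: notin; rewrite third_adj_sym.
      move: h1 h2 => /= /eqP <- /eqP eqv.
      by move: jv; rewrite -ij eqv !inE eqxx.
    * have := notin _ _ h1.
      by move: h2 h3 => /= /eqP-> /eqP<-; rewrite ij !inE eqxx.
    * have := notin _ _ h1; rewrite third_adj_sym in h3.
      have := notin _ _ h3; rewrite -ij => jl' il.
      have ll' := edgeP _ _ _ jl' il.
      by move: h2 => /= /andP[_]; rewrite ll' eqxx.
- move=> v; apply: leq_trans s0.
  rewrite -(cards1 (enum_rank (inr [set v]%SET : (G + {set G})%type))).
  apply/subset_leq_card/fintype.subsetP => _ /imsetP[i iv ->].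
  move: iv; rewrite !inE => /andP[vi /eqP ei].
  apply/eqP; congr enum_rank; congr inr.
  rewrite /= ei; apply/finset.setP => w; rewrite !inE.
  by case: eqP => //= ->; apply/esym/negbTE/negP => /eqP iv;
     rewrite iv adj_irr in vi.
Qed.

Definition chi_vi (s : nat) (s0 : (0 < s)%N) : nat :=
  ex_minn (ks_colorable_ex s0).

End Incidences.

Arguments chi_vi G s s0 : clear implicits.

Local Open Scope classical_set_scope.
Local Open Scope ring_scope.

Section Drawings.
Variables (R : realType) (G : sgraph).
Implicit Types (pos : G -> R * R) (curve : {set G} -> set (R * R)).

Definition arc_between (A : set (R * R)) (x y : R * R) : Prop :=
  exists g : R -> R * R,
    [/\ {within `[0, 1], continuous g},
        {in `[0, 1] &, injective g},
        g 0 = x, g 1 = y & A = g @` `[0, 1]].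

Definition plane_drawing pos curve : Prop :=
  [/\ injective pos,
      forall u v, adj u v -> arc_between (curve [set u; v]%SET) (pos u) (pos v),
      forall e w, e \in edges G -> curve e (pos w) -> w \in e &
      forall e f, e \in edges G -> f \in edges G -> e != f ->
        curve e `&` curve f `<=` pos @` [set w | w \in e /\ w \in f]].

Definition drawing_set pos curve : set (R * R) :=
  range pos `|` \bigcup_(e in [set e | e \in edges G]) curve e.

Definition face (D F : set (R * R)) : Prop :=
  exists2 z, (~` D) z & F = connected_component (~` D) z.

Definition outer_face (D F : set (R * R)) : Prop :=
  face D F /\ ~ bounded_set F.

(* pos v lies in the drawing, which is disjoint from F, so closure F (pos v)
   says that pos v is on the boundary of the outer face F. *)
Definition outerplanar : Prop :=
  exists pos curve, plane_drawing pos curve /\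
    exists2 F, outer_face (drawing_set pos curve) F &
      forall v, closure F (pos v).

End Drawings.

(* Main.v *)
Require Import Defs.
From mathcomp Require Import all_boot zify.

(** Outerplanarity is used through two obstructions.  Take a point [z] of the
    face that touches all vertices and join it to every vertex: a path in the
    face, then a short segment inside a ball around the vertex that meets only
    curves ending there.  This makes [G] plus a cone point [z] into a drawing
    in which independent edges are disjoint, hence at positive distance.
    Replacing curves by fine finite chains of points, the crossing numbers of
    a chain with horizontal rays issued from the end points of the other chain
    satisfy a linear relation (sum over the small squares of the grid
    parametrising a pair of chains).  Summing these relations over all pairs
    of independent edges of K5 or K3,3 contradicts parity, as in the theorems
    of van Kampen and Hanani-Tutte; no Jordan curve theorem is needed.

    Let [S] be a vertex set all of whose degrees are 2 or 3, and let [T] be a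
    minimal nonempty part of [S] left by at most one edge.  A longest cycle of
    [T] is Hamiltonian (otherwise an ear gives a longer cycle or a K2,3), its
    chords do not cross (otherwise there is a K4), and a shortest chord that
    does not enclose the vertex with the leaving edge cuts off either two
    adjacent vertices of degree 2 or a triangle with a vertex of degree 2.
    Together with vertices of degree at most 1 these are the configurations
    that can be removed, coloured inductively, and put back. *)

Set Implicit Arguments.
Unset Strict Implicit.
Unset Printing Implicit Defensive.

(** * Cycles and chords *)

Section Joins.
Local Open Scope set_scope.
Variable G : sgraph.
Implicit Types (X Y : {set G}) (u v : G).

Definition inside X : rel G := [rel x y | [&& adj x y, x \in X & y \in X]].
(** [connect] is reflexive, so [u \in X] has to be asked separately; membership of [v] then
    follows. *)
Definition joins X u v := (u \in X) && connect (inside X) u v.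

Lemma inside_sym X : symmetric (inside X).
Proof. by move=> x y; rewrite /inside /= adj_sym [(x \in X) && _]andbC. Qed.

Lemma joins_trans X : transitive (joins X).
Proof.
move=> v u w /andP[uX uv] /andP[_ vw]; rewrite /joins uX.
exact: connect_trans uv vw.
Qed.

Lemma joins_mem X u v : joins X u v -> v \in X.
Proof.
case/andP=> uX /connectP[s + ->]; case/lastP: s => // s x.
by rewrite rcons_path last_rcons => /andP[_ /and3P[]].
Qed.

Lemma joins_sym X u v : joins X u v -> joins X v u.
Proof.
move=> j; rewrite /joins (joins_mem j) (sym_connect_sym (inside_sym X)).
by case/andP: j.
Qed.

Lemma joins1 X u v : adj u v -> u \in X -> v \in X -> joins X u v.
Proof. by move=> uv uX vX; rewrite /joins uX connect1 // /inside /= uv uX. Qed.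

Lemma joins_refl X u : u \in X -> joins X u u.
Proof. by move=> uX; rewrite /joins uX connect0. Qed.

Lemma path_joins X u s :
  path adj u s -> {subset u :: s <= X} -> joins X u (last u s).
Proof.
elim: s u => [|v s IH] u /=; first by move=> _ /(_ u (mem_head _ _))/joins_refl.
move=> /andP[uv ps] sX; apply: joins_trans (IH v ps _).
  by apply: joins1 => //; apply: sX; rewrite !inE eqxx ?orbT.
by move=> x xs; apply: sX; rewrite inE xs orbT.
Qed.

Lemma joinsP X u v : joins X u v ->
  exists s, [/\ path adj u s, last u s = v, uniq (u :: s) & {subset u :: s <= X}].
Proof.
case/andP=> uX /connectP[s0 ps0 ->]; case/shortenP: ps0 => s ps us _.
exists s; split=> //; first by apply: sub_path ps => x y /and3P[].
move=> x; rewrite inE => /orP[/eqP->//|].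
elim: s u ps {uX us s0} => // y s IH u /= /andP[/and3P[_ _ yX] ps].
by rewrite inE => /orP[/eqP->//|]; apply: IH ps.
Qed.

End Joins.

Section Structure.
Local Open Scope set_scope.
Variable G : sgraph.
Implicit Types (A B C S T X Y Z : {set G}) (u v x y : G) (c : seq G).

Hypothesis deg3 : forall v, #|neighbours v| <= 3.

(** A cone point turns K4 into K5 and K2,3 into K3,3. [X i j] carries the connection from [p i] to
    [p j]. *)
Hypothesis no_K4 : forall (p : nat -> G) (X : nat -> nat -> {set G}),
  (forall i j, i < j < 4 -> joins (X i j) (p i) (p j)) ->
  (forall i j k, i < j < 4 -> k < 4 -> k != i -> k != j -> p k \notin X i j) ->
  (forall i j k l, [&& i < j, j < 4, k < l, l < 4, i < k, j != k & j != l] ->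
     [disjoint X i j & X k l]) ->
  False.

(** In this K2,3 the connections at [a] are single edges, while the one from [b] to [c i] runs
    through [X i]. *)
Hypothesis no_K23 : forall (a b : G) (c : nat -> G) (X : nat -> {set G}),
  (forall i, i < 3 -> adj a (c i)) ->
  (forall i, i < 3 -> joins (X i) b (c i)) ->
  (forall i, i < 3 -> a \notin X i) ->
  (forall i j, i < 3 -> j < 3 -> i != j -> c j \notin X i) ->
  False.

Definition degree S v := #|neighbours v :&: S|.

Definition cross A B : {set G * G} :=
  [set p | [&& p.1 \in A, p.2 \in B & adj p.1 p.2]].

Lemma card_crossC A B : #|cross A B| = #|cross B A|.
Proof.
have inj : injective (fun p : G * G => (p.2, p.1)) by move=> [? ?] [? ?] [-> ->].
rewrite -(card_imset _ inj); apply: eq_card => -[x y]; rewrite !inE /=.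
apply/imsetP/and3P => [[[a b] + [-> ->]]|[xB yA xy]].
  by rewrite inE /= adj_sym => /and3P[].
by exists (y, x); rewrite // inE /= adj_sym xy xB yA.
Qed.

Lemma card_crossD A B T : A \subset T ->
  #|cross T B| = #|cross A B| + #|cross (T :\: A) B|.
Proof.
move=> AT; rewrite -(cardsID [set p | p.1 \in A] (cross T B)).
congr (_ + _); apply: eq_card => -[x y]; rewrite !inE /=.
  by case: (boolP (x \in A)) => [/(subsetP AT)->|_]; rewrite ?andbF ?andbT.
by case: (x \in A); rewrite ?andbF.
Qed.

Lemma card_cross1 S v : #|cross [set v] S| = degree S v.
Proof.
rewrite /degree; have inj : injective (fun y : G => (v, y)) by move=> ? ? [].
rewrite -(card_imset _ inj); apply: eq_card => -[x y]; rewrite !inE /=.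
apply/and3P/imsetP => [[/eqP-> yS vy]|[z + [-> ->]]].
  by exists y; rewrite // !inE vy.
by rewrite !inE => /andP[-> ->].
Qed.

Definition is_cycle T c :=
  [&& uniq c, cycle adj c, 2 < size c & all (mem T) c].

(** * A minimal part left by at most one edge, and its Hamiltonian cycle *)

Section MinimalPart.
Variables S T : {set G}.
Hypothesis degS : forall v, v \in S -> 1 < degree S v.
Hypothesis TS : T \subset S.
Hypothesis T0 : T != set0.
Hypothesis cutT : #|cross T (S :\: T)| <= 1.
Hypothesis minT : forall Y, Y \subset S -> Y != set0 ->
  #|cross Y (S :\: Y)| <= 1 -> #|T| <= #|Y|.

(** At most one edge of [S] leaves [T], so one of [Y] and [T :\: Y] sends no edge to [S :\: T]. If
    at most one edge joined the two, that one would contradict the minimality of [T]. *)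
Lemma two_edges Y : Y \subset T -> Y != set0 -> Y != T ->
  1 < #|cross Y (T :\: Y)|.
Proof.
move=> YT Y0 YnT; rewrite ltnNge; apply/negP => cutY.
have TY0 : T :\: Y != set0.
  by apply: contra YnT; rewrite setD_eq0 eqEsubset YT => ->.
have TYT : T :\: Y \subset T by apply: subsetDl.
have split_cut : #|cross Y (S :\: T)| + #|cross (T :\: Y) (S :\: T)| <= 1.
  by rewrite -card_crossD.
have part Z : Z \subset T -> #|cross Z (S :\: Z)| =
    #|cross Z (T :\: Z)| + #|cross Z (S :\: T)|.
  move=> ZT; rewrite !(card_crossC Z).
  have ST : T :\: Z \subset S :\: Z by apply: setSD.
  rewrite (card_crossD _ ST); congr (_ + #|cross _ _|).
  apply/setP => x; rewrite !inE.
  by case: (boolP (x \in Z)) => [/(subsetP ZT)->|_]; rewrite ?andbF //= andbT.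
have small Z : Z \subset T -> Z != set0 -> Z != T ->
    #|cross Z (T :\: Z)| + #|cross Z (S :\: T)| <= 1 -> False.
  move=> ZT Z0 ZnT; rewrite -part // => /minT.
  rewrite (subset_trans ZT TS) // => /(_ isT Z0); apply/negP.
  by rewrite -ltnNge proper_card // properEneq ZnT.
have [c0|c1] := posnP #|cross Y (S :\: T)|.
  by apply: (small Y) => //; rewrite c0 addn0.
apply: (small (T :\: Y)) => //.
  by apply: contra Y0 => /eqP E; rewrite -(setIidPr YT) -E setIDAC setDIl setDv setI0.
have -> : T :\: (T :\: Y) = Y by rewrite setDDr setDv set0U (setIidPr YT).
by rewrite card_crossC; move: split_cut c1; lia.
Qed.

(** Let [Y] be the component of some [y] in [T :\: C]. Every edge from [Y] to the rest of [T] ends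
    in [C], and [two_edges] provides two of them. They may share an end on either side. *)
Lemma ear C : C \subset T -> C != set0 -> C != T ->
  exists x1 y1 x2 y2, [/\ (x1 \in C) && (x2 \in C), adj x1 y1, adj x2 y2,
    (x1, y1) != (x2, y2) & joins (T :\: C) y1 y2].
Proof.
move=> CT C0 CnT.
have [y yTC] : exists y, y \in T :\: C.
  by apply/set0Pn; apply: contra CnT; rewrite setD_eq0 eqEsubset CT => ->.
pose Y := [set w | joins (T :\: C) y w].
have YTC : Y \subset T :\: C.
  by apply/subsetP => w; rewrite inE => /joins_mem.
have [x xC] := set0Pn _ C0.
have YT : Y \subset T by apply: subset_trans YTC (subsetDl _ _).
have Y0 : Y != set0 by apply/set0Pn; exists y; rewrite inE joins_refl.
have YnT : Y != T.
  apply: contraTneq (subsetP CT _ xC) => <-; apply/negP => /(subsetP YTC).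
  by rewrite inE xC.
have edge p : p \in cross Y (T :\: Y) -> (p.2 \in C) /\ joins (T :\: C) y p.1.
  case: p => a b; rewrite !inE /= => /and3P[ya /andP[nyb bT] ab]; split=> //.
  apply: contraNT nyb => bC; apply: (joins_trans ya).
  by apply: joins1; rewrite ?(joins_mem ya) // inE bC.
have /card_gt1P[[y1 x1] [[y2 x2] [h1 h2 ne]]] := two_edges YT Y0 YnT.
exists x1, y1, x2, y2; have [/= x1C j1] := edge _ h1; have [/= x2C j2] := edge _ h2.
move: h1 h2; rewrite !inE /= => /and3P[_ _ h1] /and3P[_ _ h2].
split=> //; rewrite ?x1C // 1?adj_sym //.
  by apply: contra ne => /eqP[-> ->].
exact: joins_trans (joins_sym j1) j2.
Qed.

Lemma T_not_singleton x : T != [set x].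
Proof.
apply/eqP => E; have xS : x \in S by apply: (subsetP TS); rewrite E set11.
move: cutT; rewrite E card_cross1 leqNgt => /negP; apply.
rewrite /degree (_ : _ :&: _ = neighbours x :&: S); first exact: degS.
apply/setP => y; rewrite !inE; case: eqP => [->|//]; by rewrite adj_irr.
Qed.

(** An ear at a single vertex starts and ends there, so it closes up to a cycle; its two inner ends
    differ, which gives length at least 3. *)
Lemma cycle_exists : exists c, is_cycle T c.
Proof.
have [x xT] := set0Pn _ T0.
have [|||x1 [y1 [x2 [y2 [+ xy1 xy2 ne j]]]]] := @ear [set x].
- by rewrite sub1set.
- by apply/set0Pn; exists x; rewrite set11.
- by rewrite eq_sym T_not_singleton.
rewrite !inE => /andP[/eqP x1x /eqP x2x]; subst x1 x2.
have [s [ps ls us sT]] := joinsP j.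
have {ne} : y1 != y2 by apply: contra ne => /eqP->.
rewrite -ls; case: s ps ls us sT => [|z s] //=; first by rewrite eqxx.
move=> ps ls us sT _; exists [:: x, y1, z & s]; apply/and4P; split=> //.
- apply/andP; split=> //; apply/negP => /sT; by rewrite !inE eqxx.
- have -> : cycle adj [:: x, y1, z & s] = path adj x (rcons [:: y1, z & s] x) by [].
  by rewrite rcons_path /= xy1 ps ls adj_sym.
- apply/allP => w; rewrite inE => /orP[/eqP->//|/sT]; by rewrite !inE => /andP[].
Qed.

Lemma longest_cycle : exists c, is_cycle T c /\
  forall c', is_cycle T c' -> size c' <= size c.
Proof.
pose P n := [exists t : n.-tuple G, is_cycle T t].
have exP : exists n, P n.
  by have [c hc] := cycle_exists; exists (size c); apply/existsP; exists (in_tuple c).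
have bound n : P n -> n <= #|T|.
  case/existsP=> t /and4P[ut _ _ tT]; rewrite -(size_tuple t) -(card_uniqP ut).
  by apply/subset_leq_card/subsetP => x /(allP tT).
case: (ex_maxnP exP bound) => n /existsP[t ht] max; exists t; split=> // c hc.
by rewrite size_tuple; apply: max; apply/existsP; exists (in_tuple c).
Qed.

Lemma cycle_mem c x : is_cycle T c -> x \in c -> x \in T.
Proof. by case/and4P=> _ _ _ /allP h /h. Qed.

Lemma hamiltonian_cycle : exists c, is_cycle T c /\ c =i T.
Proof.
have [c [hc max]] := longest_cycle; exists c; split=> // x.
apply/idP/idP => [|xT]; first exact: cycle_mem.
suff E : [set y in c] = T by rewrite -E inE in xT.
apply/eqP; apply: contraT => cnT; exfalso.
have [|||x1 [y1 [x2 [y2 [+ xy1 xy2 ne j]]]]] := @ear [set y in c].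
- by apply/subsetP => y; rewrite inE; apply: cycle_mem.
- have /and4P[_ _ + _] := hc; case: (c) => // y ? _.
  by apply/set0Pn; exists y; rewrite !inE eqxx.
- exact: cnT.
rewrite !inE => /andP[x1c x2c].
have [s [ps ls us sT]] := joinsP j.
have [i p cE] := rot_to x1c.
have {}hc : is_cycle T (x1 :: p).
  rewrite -cE /is_cycle rot_uniq rot_cycle size_rot.
  by case/and4P: hc => -> -> -> /=; rewrite (eq_all_r (mem_rot i c)).
have {}max c' : is_cycle T c' -> size c' <= size (x1 :: p).
  by rewrite -cE size_rot; apply: max.
have memc y : (y \in c) = (y \in x1 :: p) by rewrite -cE mem_rot.
have out y : y \in y1 :: s -> (y \in T) && (y \notin x1 :: p).
  by move=> /sT; rewrite !inE memc andbC inE.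
have [uc cc sc cT] := and4P hc.
move: x2c; rewrite memc inE => {memc cE x1c cnT} /orP[/eqP x21|x2p].
  (* Both ends of the ear attach at [x1], which then has four distinct neighbours. *)
  subst x2; have y12 : y1 != y2 by apply: contra ne => /eqP->.
  have y2s : y2 \in y1 :: s by rewrite -ls mem_last.
  case: p hc max out {cT} uc cc sc => [|h p] //; case/lastP: p => [|p l] //=.
  move=> hc max out uc; rewrite rcons_path last_rcons => /and3P[xh _ lx] _.
  have uq : uniq [:: h; l; y1; y2].
    move: uc; rewrite mem_rcons inE => /andP[_ /andP[/norP[hl _] _]].
    have mh : h \in [:: x1, h & rcons p l] by rewrite !inE eqxx ?orbT.
    have ml : l \in [:: x1, h & rcons p l] by rewrite !inE mem_rcons mem_head !orbT.
    have nq y z : y \in y1 :: s -> z \in [:: x1, h & rcons p l] -> z != y.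
      by move=> /out/andP[_ +] zc; apply: contraNneq => <-.
    by rewrite /= !inE !negb_or hl y12 !(nq y1) ?mem_head // !(nq y2).
  have := deg3 x1; rewrite leqNgt => /negP; apply.
  rewrite -[4]/(size [:: h; l; y1; y2]) -(card_uniqP uq).
  apply/subset_leq_card/subsetP => z.
  by rewrite !inE => /or4P[]/eqP->; rewrite // adj_sym.
move: hc max out {cT} uc cc sc; case/splitPr: x2p => p1 p2 hc max out uc cc sc.
have [_ _ _ cT] := and4P hc.
(* A cycle through all old vertices and the whole ear would exceed the maximal length. *)
have longer c' : cycle adj c' ->
    perm_eq c' ((y1 :: s) ++ x1 :: p1 ++ x2 :: p2) -> False.
  move=> cc' pc'; have sc' := perm_size pc'; rewrite size_cat /= in sc'.
  have /max : is_cycle T c'; last by rewrite sc' addSn ltnNge leq_addl.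
  rewrite /is_cycle cc' (perm_uniq pc') (perm_all _ pc') all_cat cT cat_uniq us uc.
  rewrite !(andTb, andbT); apply/and3P; split.
  - by apply/hasPn => y yc; apply/negP => /out/andP[_]; rewrite yc.
  - by rewrite sc' (leq_trans sc (leq_addl _ _)).
  - by apply/allP => y /out/andP[].
have pn : path adj x1 (rcons (p1 ++ x2 :: p2) x1) by exact: cc.
have px : path adj x1 (y1 :: s) && adj (last y1 s) x2 by rewrite /= xy1 ps ls adj_sym.
(* If [x1] and [x2] are consecutive on the cycle, in either order, the ear can replace the edge
   between them. *)
case: p1 => [|h p1] in hc max out uc cc sc cT longer pn *.
  apply: (longer (x1 :: (y1 :: s) ++ x2 :: p2)).
    rewrite /cycle rcons_cat cat_path; case/andP: px => -> /= ->.
    by case/andP: pn.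
  by rewrite -(cat1s x1) -[x1 :: [::] ++ _](cat1s x1) perm_catCA.
case/lastP: p2 => [|p2 l] in hc max out uc cc sc cT longer pn *.
  apply: (longer ((x1 :: h :: p1) ++ x2 :: rev (y1 :: s))).
    have -> : cycle adj ((x1 :: h :: p1) ++ x2 :: rev (y1 :: s)) =
        path adj x1 (rcons (h :: p1) x2 ++ rcons (rev (y1 :: s)) x1).
      by rewrite cat_rcons -rcons_cons -rcons_cat.
    rewrite cats1 rcons_path in pn; case/andP: pn => pn _.
    rewrite cat_path last_rcons pn /=.
    have := rev_path adj x1 (rcons (y1 :: s) x2).
    rewrite belast_rcons last_rcons [rev (x1 :: _)]rev_cons => ->.
    under eq_path do rewrite adj_sym.
    by rewrite rcons_path.
  rewrite -cat_rcons -cats1 perm_catC; apply: perm_cat; last by [].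
  by rewrite perm_rev.
have [p1E p2E] : path adj x1 (rcons (h :: p1) x2) /\ path adj x2 (rcons p2 l).
  have := pn; rewrite rcons_cat cat_path rcons_cons => /andP[a bb].
  have /= /andP[b d] := bb; rewrite rcons_path in d; case/andP: d => d _.
  by move: a => /= /andP[-> a2]; rewrite rcons_path a2 b.
have lx1 : adj l x1.
  by move: pn; rewrite rcons_path last_cat /= last_rcons => /andP[].
(* Otherwise three paths run from [x1] to [x2]: the ear and two arcs of the cycle. The branch
   vertices of the K2,3 are their first vertices after [x1]. *)
pose br i := match i with 0 => y1 | 1 => h | _ => l end.
pose X i := match i with 0 => [set y in x2 :: y1 :: s]
  | 1 => [set y in x2 :: h :: p1] | _ => [set y in x2 :: rcons p2 l] end.
move: uc; rewrite cons_uniq cat_uniq mem_cat negb_or => /andP[/andP[x1a x1b]].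
case/and3P=> u1 /hasPn d12 /andP[x2l u2].
have lm : l \in rcons p2 l by rewrite mem_rcons mem_head.
have nout z : z \in x1 :: (h :: p1) ++ x2 :: rcons p2 l -> z \notin y1 :: s.
  by move=> zc; apply/negP => /out/andP[_]; rewrite zc.
have nx1 : x1 \notin y1 :: s by apply: nout; rewrite mem_head.
have nh : h \notin y1 :: s by apply: nout; rewrite !inE eqxx orbT.
have nl : l \notin y1 :: s.
  by apply: nout; rewrite inE mem_cat [l \in x2 :: _]inE lm !orbT.
have ny1 : y1 \notin x1 :: (h :: p1) ++ x2 :: rcons p2 l.
  by have /andP[] := out y1 (mem_head _ _).
have ny1a : y1 \notin h :: p1.
  by apply: contra ny1; rewrite [y1 \in x1 :: _]in_cons mem_cat => ->; rewrite orbT.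
have ny1b : y1 \notin x2 :: rcons p2 l.
  by apply: contra ny1; rewrite [y1 \in x1 :: _]in_cons mem_cat => ->; rewrite !orbT.
have lh : l \notin h :: p1 by apply: d12; rewrite inE lm orbT.
have hl : h \notin x2 :: rcons p2 l.
  by apply/negP => /d12 /=; rewrite mem_head.
have x2h : x2 \notin h :: p1 by apply: d12; rewrite mem_head.
have lx2 : x2 != l by apply: contraNneq x2l => ->.
apply: (no_K23 (a := x1) (b := x2) (c := br) (X := X)).
- by case=> [|[|k]] _ //=; [case/andP: p1E|rewrite adj_sym].
- case=> [|[|k]] _ /=.
  + apply: joins_sym; have := @path_joins G (X 0) y1 (rcons s x2).
    rewrite last_rcons; apply => /=.
      by rewrite rcons_path ps ls adj_sym xy2.
    by move=> y yX; rewrite inE -mem_rcons.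
  + apply: joins_sym; have := @path_joins G (X 1) h (rcons p1 x2).
    rewrite last_rcons; apply => /=.
      by case/andP: p1E.
    by move=> y yX; rewrite inE -mem_rcons.
  + have := @path_joins G (X 2) x2 (rcons p2 l); rewrite last_rcons; apply => //.
    by move=> y yX; rewrite inE.
- case=> [|[|k]] _ /=; rewrite inE // in_cons negb_or.
    by rewrite nx1 andbT; move: x1b; rewrite inE negb_or => /andP[].
  by rewrite x1a andbT; move: x1b; rewrite inE negb_or => /andP[].
- case=> [|[|[|k]]] [|[|[|j']]] // _ _ _ /=; rewrite inE // in_cons negb_or.
  + by rewrite nh andbT; move: hl; rewrite inE negb_or => /andP[].
  + by rewrite nl andbT eq_sym.
  + by rewrite ny1a andbT; move: ny1b; rewrite inE negb_or => /andP[].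
  + by rewrite lh andbT eq_sym.
Qed.

End MinimalPart.

(** * Chords of the Hamiltonian cycle *)

Lemma is_cycle_rot T c i : is_cycle T (rot i c) = is_cycle T c.
Proof.
by rewrite /is_cycle rot_uniq rot_cycle size_rot (eq_all_r (mem_rot i c)).
Qed.

Lemma cycle_adj T c x0 i : is_cycle T c -> i.+1 < size c ->
  adj (nth x0 c i) (nth x0 c i.+1).
Proof.
case/and4P=> _ + _ _; case: c => // y c /= /(pathP x0) h ic.
have {}ic : i < size c := ic.
have := h i; rewrite size_rcons ltnS (ltnW ic) -rcons_cons !nth_rcons.
by rewrite [size (_ :: _)]/= ltnS (ltnW ic) ic; apply.
Qed.

Lemma cycle_adj_last T c x0 : is_cycle T c ->
  adj (nth x0 c 0) (nth x0 c (size c).-1).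
Proof.
case/and4P=> _ + + _; case: c => // y c; rewrite nth_last /= rcons_path.
by rewrite adj_sym => /andP[].
Qed.

(** The chords are opposite edges of a K4 on the positions 0, [i], [j], [k]; the four arcs between
    consecutive positions are its other edges. *)
Lemma no_crossing_chords T c x0 i j k : is_cycle T c ->
  0 < i < j -> j < k < size c ->
  adj (nth x0 c 0) (nth x0 c j) -> adj (nth x0 c i) (nth x0 c k) -> False.
Proof.
move=> hc ij jk a0j aik.
have [uc _ sc _] := and4P hc.
(* Vertex sets are described by positions on the cycle, so that disjointness becomes arithmetic. *)
pose ix (P : pred nat) := [set y in c | P (index y c)].
have mem_ix (P : pred nat) m : m < size c -> (nth x0 c m \in ix P) = P m.
  by move=> mc; rewrite !inE mem_nth // index_uniq.
have dis (P Q : pred nat) : (forall m, P m -> Q m -> False) -> [disjoint ix P & ix Q].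
  move=> PQ; apply/pred0P => y /=; rewrite !inE; apply/negP.
  by case/andP=> /andP[_ hP] /andP[_ hQ]; apply: PQ hP hQ.
have arc (P : pred nat) a b : a <= b < size c -> (forall m, a <= m <= b -> P m) ->
    joins (ix P) (nth x0 c a) (nth x0 c b).
  case/andP; elim: b => [|b IH] ab bc hP.
    by move: ab; rewrite leqn0 => /eqP a0; subst a; apply: joins_refl; rewrite mem_ix // hP.
  move: ab; rewrite leq_eqVlt => /orP[/eqP ab|ab].
    by subst a; apply: joins_refl; rewrite mem_ix // hP // leqnn.
  apply: (joins_trans (IH ab (ltnW bc) _)).
    by move=> m /andP[am mb]; rewrite hP // am ltnW.
  apply: joins1; rewrite ?(cycle_adj _ hc) ?mem_ix ?(ltnW bc) // hP ?leqnn ?andbT //.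
    by rewrite leqnSn andbT.
  exact: ltnW.
pose p m := nth x0 c (nth 0 [:: 0; i; j; k] m).
(* The case 0, 3 is the arc from [k] over the closing edge of the cycle back to 0. *)
pose X a b := ix (match a, b with
  | 0, 1 => fun m => m <= i
  | 0, 2 => fun m => (m == 0) || (m == j)
  | 0, _ => fun m => (m == 0) || (k <= m)
  | 1, 2 => fun m => i <= m <= j
  | 1, _ => fun m => (m == i) || (m == k)
  | _, _ => fun m => j <= m <= k end).
have c0 : 0 < size c by apply: ltn_trans sc.
have ic : i < size c by lia.
have jc : j < size c by lia.
have kc : k < size c by lia.
apply: (no_K4 (p := p) (X := X)).
- case=> [|[|[|[|a]]]] [|[|[|[|b]]]] //= h; try (by exfalso; move: h; clear; lia);
    rewrite /p /X /= {h}.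
  + by apply: arc; [lia|move=> m; lia].
  + by apply: joins1; rewrite // mem_ix ?eqxx ?orbT.
  + apply: joins_trans (joins_sym (arc _ k (size c).-1 _ _)); [|lia|move=> m; lia].
    by apply: joins1; rewrite ?(cycle_adj_last _ hc) ?mem_ix //; lia.
  + by apply: arc; [lia|move=> m; lia].
  + by apply: joins1; rewrite // mem_ix ?eqxx ?orbT.
  + by apply: arc; [lia|move=> m; lia].
- case=> [|[|[|[|a]]]] [|[|[|[|b]]]] [|[|[|[|d]]]] //= h _ _ _;
    try (by exfalso; move: h; clear; lia); by rewrite /p /X mem_ix //=; lia.
- case=> [|[|[|[|a]]]] [|[|[|[|b]]]] [|[|[|[|d]]]] [|[|[|[|e]]]] //= h;
    try (by exfalso; move: h; clear; lia); by apply: dis => m; lia.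
Qed.

Lemma nth_rot_add (x0 : G) c a m : a + m < size c ->
  nth x0 (rot a c) m = nth x0 c (a + m).
Proof.
by move=> amc; rewrite /rot nth_cat size_drop ltn_subRL amc nth_drop.
Qed.

Lemma nth_rot_sub (x0 : G) c a m : m < a <= size c ->
  nth x0 (rot a c) (size c - a + m) = nth x0 c m.
Proof.
case/andP=> ma ac; rewrite /rot nth_cat size_drop ltnNge leq_addr addKn.
by rewrite nth_take.
Qed.

Definition reducible S :=
  (exists u v, [/\ u \in S, v \in S, adj u v, degree S u = 2 & degree S v = 2]) \/
  (exists u v w, [/\ [&& u \in S, v \in S & w \in S], adj u v, adj u w, adj v w
     & degree S u = 2]).

Lemma reducible_exists S : S != set0 -> (forall v, v \in S -> 1 < degree S v) ->
  reducible S.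
Proof.
move=> S0 degS.
pose small (T : {set G}) := [&& T \subset S, T != set0 & #|cross T (S :\: T)| <= 1].
have smallS : small S.
  rewrite /small subxx S0 setDv (_ : cross _ _ = set0) ?cards0 //.
  by apply/setP => -[x y]; rewrite !inE andbF.
case: (arg_minnP (fun T : {set G} => #|T|) smallS) => T /and3P[TS T0 cutT] minT.
have {}minT Y : Y \subset S -> Y != set0 -> #|cross Y (S :\: Y)| <= 1 -> #|T| <= #|Y|.
  by move=> h1 h2 h3; apply: minT; rewrite /small h1 h2.
have [c1 [hc1 c1T]] := hamiltonian_cycle degS TS T0 cutT minT.
(* Only [t0] may have neighbours in [S] outside [T]. *)
have [t0 t0T ht0] : exists2 t0, t0 \in T &
    forall x y, x \in T -> x != t0 -> y \in S -> adj x y -> y \in T.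
  have [E|/set0Pn[[t0 y0] ty]] := eqVneq (cross T (S :\: T)) set0.
    have [t0 tT] := set0Pn _ T0; exists t0 => // x y xT _ yS xy.
    apply: contraT => yT; have : (x, y) \in cross T (S :\: T) by rewrite !inE /= xT yT yS.
    by rewrite E inE.
  exists t0; first by move: ty; rewrite inE => /and3P[].
  move=> x y xT xt yS xy; apply: contraT => yT.
  have h : (x, y) \in cross T (S :\: T) by rewrite !inE /= xT yT yS.
  move: cutT; rewrite leqNgt => /negP[]; apply/card_gt1P.
  by exists (x, y), (t0, y0); split=> //; apply: contra xt => /eqP[-> _].
move: (t0T); rewrite -c1T => /rot_to[i p cE].
(* With [t0] at position 0, it never lies strictly between two positions. *)
have [c [hc cT c0]] : exists c, [/\ is_cycle T c, c =i T & nth t0 c 0 = t0].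
  exists (t0 :: p); split=> //; first by rewrite -cE is_cycle_rot.
  by move=> x; rewrite -cE mem_rot c1T.
have [uc _ sc _] := and4P hc.
have sc0 : 0 < size c by apply: ltn_trans sc.
pose n m := nth t0 c m.
(* The closing edge of the cycle counts as a chord of span [size c - 1], so a shortest chord exists.
   Spans are differences of positions and do not wrap around. *)
pose P d := [exists a : 'I_(size c), exists b : 'I_(size c),
  [&& b == a + d :> nat, 1 < d & adj (n a) (n b)]].
have exP : exists d, P d.
  have s2 : 1 < (size c).-1 by move: sc; clear; lia.
  have l1 : (size c).-1 < size c by rewrite ltn_predL; apply: ltn_trans sc.
  exists (size c).-1; apply/existsP.
  exists (Ordinal (ltn_trans (ltn_trans (isT : 0 < 1) (isT : 1 < 2)) sc)).
  apply/existsP; exists (Ordinal l1); rewrite /= add0n eqxx (cycle_adj_last _ hc) andbT.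
  exact: s2.
case: (ex_minnP exP) => d /existsP[a /existsP[b /and3P[/eqP bad d1 ab]]] mind.
case: a b => [a ac] [b bc] /= in bad ab.
have {}mind r s : r.+1 < s < size c -> adj (n r) (n s) -> d <= s - r.
  move=> rs adrs; apply: mind; have rc : r < size c by move: rs; clear; lia.
  have scc : s < size c by move: rs; clear; lia.
  apply/existsP; exists (Ordinal rc); apply/existsP; exists (Ordinal scc) => /=.
  by rewrite adrs andbT; move: rs; clear; lia.
have nS m : m < size c -> n m \in S by move=> mc; rewrite (subsetP TS) // -cT mem_nth.
(* A third neighbour at position [s] gives a chord crossing the shortest one if [s] lies outside the
   range from [a] to [b], and a chord of smaller span otherwise. *)
have interior r : a < r < b -> degree S (n r) = 2.
  move=> arb; have rc : r < size c by lia.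
  have rS := nS r rc; apply/eqP; rewrite eqn_leq degS // andbT.
  have : neighbours (n r) :&: S \subset [set n r.-1; n r.+1].
    apply/subsetP => y; rewrite !inE => /andP[ry yS].
    have yT : y \in T.
      apply: (ht0 (n r)) => //; first by rewrite -cT mem_nth.
      have : n r != n 0 by rewrite nth_uniq //; move: arb rc; clear; lia.
      by rewrite {2}/n c0.
    move: yT; rewrite -cT => /(nthP t0)[s sc' ys]; rewrite -ys in ry *.
    apply/norP => -[n1 n2]; rewrite -!/(n _) in n1 n2 ry.
    have sr : s != r by apply: contraTneq ry => ->; rewrite adj_irr.
    have {n1} n1 : s != r.-1 by apply: contraNneq n1 => ->.
    have {n2} n2 : s != r.+1 by apply: contraNneq n2 => ->.
    (* After rotation the shortest chord starts at position 0, as [no_crossing_chords] asks;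
       positions before [a] reappear at the end. *)
    have hr : is_cycle T (rot a c) by rewrite is_cycle_rot.
    have sr' : size (rot a c) = size c by rewrite size_rot.
    have na : nth t0 (rot a c) 0 = n a by rewrite nth_rot_add addn0 ?ac.
    have nb : nth t0 (rot a c) d = n b by rewrite nth_rot_add -bad.
    have nr : nth t0 (rot a c) (r - a) = n r.
      by rewrite nth_rot_add subnKC //; move: arb; clear; lia.
    have [sb|bs] := leqP s b; last first.
      have ns : nth t0 (rot a c) (s - a) = n s.
        by rewrite nth_rot_add subnKC //; move: arb bs; clear; lia.
      apply: (@no_crossing_chords T (rot a c) t0 (r - a) d (s - a)) => //.
      - by move: arb bad; clear; lia.
      - have gen N : s < N -> d < s - a < N by move: arb bad bs; clear; lia.
        by rewrite sr'; apply: gen.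
      - by rewrite na nb.
      - by rewrite nr ns.
    have [as_|sa] := leqP a s.
      have [rs|rs] := ltnP r s.
        have rs1 : r.+1 < s by move: n2 rs; clear; lia.
        have := mind r s; rewrite rs1 sc' ry => /(_ isT isT).
        by move: sb arb bad rs1; clear; lia.
      have sr1 : s.+1 < r by move: sr n1 rs; clear; lia.
      have := mind s r; rewrite sr1 rc adj_sym ry => /(_ isT isT).
      by move: as_ arb bad sr1; clear; lia.
    have ns : nth t0 (rot a c) (size c - a + s) = n s.
      by rewrite nth_rot_sub // sa ltnW.
    apply: (@no_crossing_chords T (rot a c) t0 (r - a) d (size c - a + s)) => //.
    - by move: arb bad; clear; lia.
    - have gen N : a < N -> b < N -> d < N - a + s < N.
        by move: bad sa; clear; lia.
      by rewrite sr'; apply: gen.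
    - by rewrite na nb.
    - by rewrite nr ns.
  move=> /subset_leq_card h; apply: leq_trans h _; by rewrite cards2; case: (_ != _).
(* One interior vertex gives a triangle; two or more give adjacent vertices of degree 2. *)
have [d2|d3] := ltnP d 3.
  have ba : b = a.+2 by move: bad d1 d2; clear; lia.
  have ac1 : a.+1 < size c by move: ba bc; clear; lia.
  right; exists (n a.+1), (n a), (n b); split.
  - by rewrite !nS.
  - by rewrite adj_sym; apply: cycle_adj hc _.
  - by rewrite ba; apply: cycle_adj hc _; rewrite -ba.
  - exact: ab.
  - by rewrite interior // ba !ltnSn.
have [a1 a2] : a < a.+1 < b /\ a < a.+2 < b by move: bad d3; clear; lia.
have [c1c c2c] : a.+1 < size c /\ a.+2 < size c by move: a1 a2 bc; clear; lia.
left; exists (n a.+1), (n a.+2); split; rewrite ?nS ?interior //.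
exact: cycle_adj hc _.
Qed.
End Structure.

(** * Local colourings *)

Section Local.
Implicit Types (c : nat) (nc outs ins : seq nat).

(* c is the colour of a vertex v, outs and ins those of the incidences (v, e)
   and of I2(v); in local, nc lists the colours of the neighbours of v. *)
Definition star c outs ins :=
  [&& all (fun x => x < 6) (c :: outs ++ ins), uniq (c :: outs),
      all (fun i => i \notin c :: outs) ins & size (undup ins) <= 2].

Definition local c nc outs ins := star c outs ins && (c \notin nc).

Lemma eq_mem_size_undup (s t : seq nat) : s =i t -> size (undup s) = size (undup t).
Proof.
by move=> st; apply/eqP; rewrite -uniq_size_uniq ?undup_uniq // => x; rewrite !mem_undup.
Qed.

Lemma local_perm (T : eqType) c (f g h : T -> nat) (s t : seq T) : perm_eq s t ->
  local c (map f s) (map g s) (map h s) = local c (map f t) (map g t) (map h t).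
Proof.
move=> st; have m (k : T -> nat) : perm_eq (map k s) (map k t) by apply: perm_map.
have mg : perm_eq (c :: map g s) (c :: map g t) by rewrite perm_cons.
rewrite /local /star (perm_mem (m f)) (perm_uniq mg) -!cat_cons.
rewrite (perm_all _ (perm_cat mg (m h))) (perm_all _ (m h)).
rewrite (eq_mem_size_undup (perm_mem (m h))).
by congr (_ && _); congr [&& _, _, _ & _]; apply: eq_all => x; rewrite (perm_mem mg).
Qed.

(** Serves vertices without an outer neighbour: a solution found with one stays valid once its
    entries, listed first, are dropped. *)
Lemma local_behead c a b d nc outs ins :
  local c (a :: nc) (b :: outs) (d :: ins) -> local c nc outs ins.
Proof.
case/andP=> /and4P[/= /and3P[c6 _]]; rewrite all_cat /= => /and3P[o6 _ i6].
rewrite inE negb_or => /andP[/andP[_ co] /andP[_ uo]] /andP[_ io] sz.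
rewrite inE negb_or => /andP[_ cn]; rewrite /local cn /star /= c6 all_cat o6 i6 co uo.
rewrite andbT /=; apply/andP; split.
  apply: sub_all io => x; rewrite !inE !negb_or => /and3P[-> _]; exact.
by apply: leq_trans sz; case: ifP.
Qed.

(** The symmetry of the constraints under permutations of the six colours, which justifies
    normalising a port. *)
Lemma local_map (f : nat -> nat) c nc outs ins :
  (forall x y, x < 6 -> y < 6 -> f x = f y -> x = y) -> (forall x, x < 6 -> f x < 6) ->
  all (fun x => x < 6) nc -> local c nc outs ins ->
  local (f c) (map f nc) (map f outs) (map f ins).
Proof.
move=> inj f6 n6 /andP[/and4P[a6 uo io sz] cn].
have := a6; rewrite /= all_cat => /and3P[c6 o6 i6].
have mf x s : x < 6 -> all (fun x => x < 6) s -> (f x \in map f s) = (x \in s).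
  move=> x6 /allP s6; apply/mapP/idP => [[y ys]|xs]; last by exists x.
  by move/inj => /(_ x6 (s6 y ys)) ->.
rewrite /local mf // cn andbT; apply/and4P; split.
- by rewrite -map_cat -map_cons; apply/allP => _ /mapP[x xs ->]; rewrite f6 ?(allP a6).
- rewrite -map_cons map_inj_in_uniq // => x y xs ys; apply: inj.
    by move: xs; rewrite inE => /orP[/eqP->//|/(allP o6)].
  by move: ys; rewrite inE => /orP[/eqP->//|/(allP o6)].
- apply/allP => _ /mapP[x xi ->]; rewrite -map_cons mf ?(allP i6) //=.
    exact: (allP io).
  by rewrite c6.
- apply: leq_trans sz; rewrite -(size_map f (undup ins)).
  apply: uniq_leq_size; first exact: undup_uniq.
  move=> y; rewrite mem_undup => /mapP[x xi ->].
  by apply: map_f; rewrite mem_undup.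
Qed.

(* Unlike has, this stops at the first witness under call-by-value. *)
Fixpoint some (a : nat -> bool) (s : seq nat) :=
  if s is x :: s' then if a x then true else some a s' else false.

Lemma someP a s : some a s -> exists2 x, x \in s & a x.
Proof.
elim: s => //= x s IH; case: ifP => [ax _|_ /IH[y ys ay]].
  by exists x; rewrite ?mem_head.
by exists y; rewrite // inE ys orbT.
Qed.

Definition cols := iota 0 6.

Lemma colsP a : all a cols -> forall x, x < 6 -> a x.
Proof. by move=> /allP h x x6; apply: h; rewrite mem_iota. Qed.

(** * Exhaustive searches for ports and extensions *)

Definition port_search c outs ins :=
  some (fun al => some (fun b1 => some (fun b2 =>
    [&& uniq [:: c; al; b1; b2], star c (al :: outs) (b1 :: ins)
      & star c (al :: outs) (b2 :: ins)]) cols) cols) cols.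

Lemma port_search2 : all (fun c => all (fun o1 => all (fun o2 => all (fun i1 =>
  all (fun i2 => if star c [:: o1; o2] [:: i1; i2]
                 then port_search c [:: o1; o2] [:: i1; i2] else true)
  cols) cols) cols) cols) cols.
Proof. by vm_compute. Qed.

Lemma port_search1 : all (fun c => all (fun o1 => all (fun i1 =>
  if star c [:: o1] [:: i1] then port_search c [:: o1] [:: i1] else true)
  cols) cols) cols.
Proof. by vm_compute. Qed.

Lemma port_search0 : all (fun c => port_search c [::] [::]) cols.
Proof. by vm_compute. Qed.

(** With two old neighbours, [c] and [outs] take three colours and [ins] at most two of the other
    three: [al] is a colour missed by [ins], and [b1], [b2] are the remaining two. Fewer neighbours
    leave more room. *)
Lemma port_exists c outs ins : star c outs ins ->
  size outs <= 2 -> size ins = size outs ->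
  exists al b1 b2, [/\ all (fun x => x < 6) [:: c; al; b1; b2],
    uniq [:: c; al; b1; b2], star c (al :: outs) (b1 :: ins)
    & star c (al :: outs) (b2 :: ins)].
Proof.
move=> st s2 sz; have : port_search c outs ins.
  have := st => /and4P[/= + _ _ _]; rewrite all_cat.
  case: outs ins sz s2 st => [|o1 [|o2 [|]]] [|i1 [|i2 [|]]] //= _ _ st.
  - by rewrite andbT => c6; exact: (colsP port_search0).
  - rewrite !andbT => /and3P[c6 o6 i6].
    by have := colsP (colsP (colsP port_search1 c6) o6) i6; rewrite st.
  - rewrite !andbT => /and3P[c6 /andP[o6 o6'] /andP[i6 i6']].
    by have := colsP (colsP (colsP (colsP (colsP port_search2 c6) o6) o6') i6) i6';
       rewrite st.
have c6 : c < 6 by case/and4P: st => /andP[].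
case/someP=> al + /someP[b1 + /someP[b2 + /and3P[u s1 s2']]].
rewrite !mem_iota => /andP[_ h1] /andP[_ h2] /andP[_ h3].
by exists al, b1, b2; split=> //=; rewrite c6 h1 h2 h3.
Qed.

Definition port_colors (p : seq nat) :=
  [&& size p == 4, uniq p & all (fun x => x < 6) p].

(* Up to a permutation of the colours the first port is 0, 1, 2, 3, so that
   the searches below only range over the second one. *)
Lemma normalise_port p : port_colors p -> exists f g : nat -> nat,
  [/\ p = map f (iota 0 4),
      forall x y, x < 6 -> y < 6 -> f x = f y -> x = y,
      forall x, x < 6 -> f x < 6 /\ g x < 6 &
      forall x, x < 6 -> f (g x) = x].
Proof.
case/and3P=> /eqP s4 up p6.
(* [l] lists all six colours with those of [p] first; lookup in [l] is the permutation [f], and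
   [index] its inverse [g]. *)
pose l := p ++ [seq x <- cols | x \notin p].
have ul : uniq l.
  rewrite cat_uniq up filter_uniq ?iota_uniq // !(andTb, andbT).
  by apply/hasPn => x; rewrite mem_filter => /andP[].
have ml : l =i cols.
  move=> x; rewrite mem_cat mem_filter; case: (boolP (x \in p)) => // xp.
  by rewrite orTb mem_iota (allP p6).
have sl : size l = 6 by apply/eqP; rewrite -(size_iota 0 6) -uniq_size_uniq ?iota_uniq.
have lt6 x : (x \in l) = (x < 6) by rewrite ml mem_iota.
exists (nth 0 l), (index^~ l); split.
- apply: (@eq_from_nth _ 0); first by rewrite size_map size_iota.
  move=> i; rewrite s4 => i4; rewrite (nth_map 0) ?size_iota // nth_iota //.
  by rewrite nth_cat s4 i4.
- by move=> x y x6 y6 /eqP; rewrite nth_uniq ?sl // => /eqP.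
- move=> x x6; split; first by rewrite -lt6 mem_nth // sl.
  by rewrite -sl index_mem lt6.
- by move=> x x6; rewrite nth_index // lt6.
Qed.

(** For an edge uv with both ends of degree 2: [p], [q] are the ports of the outer neighbours of u
    and v, [be] and [de] colour the incidences of u and v on the edges leading there, and [x], [y]
    colour (u, uv) and (v, uv). The tests before the last are necessary conditions that prune the
    search. *)
Definition edge_search (p q : seq nat) :=
  let A := nth 0 p 0 in let al := nth 0 p 1 in
  let B := nth 0 q 0 in let ga := nth 0 q 1 in
  some (fun be => some (fun de =>
  some (fun x => if x \in [:: al; be; de] then false else
  some (fun y => if y \in [:: be; ga; de; x] then false else
  some (fun cU => if local cU [:: A] [:: be; x] [:: al; y] then
  some (fun cV => [&& local cU [:: A; cV] [:: be; x] [:: al; y]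
                    & local cV [:: B; cU] [:: de; y] [:: ga; x]]) cols
  else false) cols) cols) cols) (drop 2 q)) (drop 2 p).

Definition all_ports (a : seq nat -> bool) :=
  all (fun B => all (fun ga => all (fun d1 => all (fun d2 =>
    if uniq [:: B; ga; d1; d2] then a [:: B; ga; d1; d2] else true)
  cols) cols) cols) cols.

Lemma all_portsP a : all_ports a -> forall q, port_colors q -> a q.
Proof.
move=> h q /and3P[]; case: q => [|B [|ga [|d1 [|d2 [|]]]]] // _ u.
case/and5P=> B6 ga6 d16 d26 _.
by have := colsP (colsP (colsP (colsP h B6) ga6) d16) d26; rewrite u.
Qed.

Lemma edge_search_ports : all_ports (edge_search (iota 0 4)).
Proof. by vm_compute. Qed.

(* For a triangle u, v, w whose vertex u has degree 2: xy is the colour of the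
   incidence (x, {x, y}), and p, q are the ports of v and w. *)
Definition triangle_search (p q : seq nat) :=
  let A := nth 0 p 0 in let al := nth 0 p 1 in
  let B := nth 0 q 0 in let ga := nth 0 q 1 in
  some (fun be => some (fun de =>
  some (fun vw => if vw \in [:: al; be; de] then false else
  some (fun wv => if wv \in [:: be; ga; de; vw] then false else
  some (fun vu => if vu \notin [:: be; vw; al; wv] then
  some (fun wu => if wu \notin [:: de; wv; ga; vw] then
  some (fun uv => if uv \in [:: al; wv] then
  some (fun uw => if uw \in [:: ga; vw] then
  some (fun cV => if local cV [:: A] [:: be; vu; vw] [:: al; uv; wv] then
  some (fun cW => if local cW [:: B; cV] [:: de; wu; wv] [:: ga; uw; vw] then
  some (fun cU => [&& local cV [:: A; cU; cW] [:: be; vu; vw] [:: al; uv; wv],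
      local cU [:: cV; cW] [:: uv; uw] [:: vu; wu]
    & local cW [:: B; cU; cV] [:: de; wu; wv] [:: ga; uw; vw]]) cols
  else false) cols else false) cols else false) cols else false) cols
  else false) cols else false) cols) cols) cols) (drop 2 q)) (drop 2 p).

Lemma triangle_search_ports : all_ports (triangle_search (iota 0 4)).
Proof. by vm_compute. Qed.

Definition triangle_ext p q be de vu vw uv uw wu wv cU cV cW :=
  [&& local cV [:: nth 0 p 0; cU; cW] [:: be; vu; vw] [:: nth 0 p 1; uv; wv],
      local cU [:: cV; cW] [:: uv; uw] [:: vu; wu]
    & local cW [:: nth 0 q 0; cU; cV] [:: de; wu; wv] [:: nth 0 q 1; uw; vw]].

Lemma triangle_searchP p q : triangle_search p q ->
  exists be de vu vw uv uw wu wv cU cV cW, [/\ be \in drop 2 p, de \in drop 2 q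
    & triangle_ext p q be de vu vw uv uw wu wv cU cV cW].
Proof.
case/someP=> be hbe /someP[de hde] /someP[vw _]; case: ifP => // _.
case/someP=> wv _; case: ifP => // _ /someP[vu _]; case: ifP => // _.
case/someP=> wu _; case: ifP => // _ /someP[uv _]; case: ifP => // _.
case/someP=> uw _; case: ifP => // _ /someP[cV _]; case: ifP => // _.
case/someP=> cW _; case: ifP => // _ /someP[cU _ h].
by exists be, de, vu, vw, uv, uw, wu, wv, cU, cV, cW.
Qed.

(** [g] renames the first port to 0, 1, 2, 3, the search covers every second port, and [f] carries
    the solution back. *)
Lemma triangle_extension p q : port_colors p -> port_colors q ->
  exists be de vu vw uv uw wu wv cU cV cW, [/\ be \in drop 2 p, de \in drop 2 q
    & triangle_ext p q be de vu vw uv uw wu wv cU cV cW].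
Proof.
move=> pp; have [f [g [-> inj f6 fg]]] := normalise_port pp.
case: q => [|B [|ga [|d1 [|d2 [|]]]]] // /and3P[_ uq /and5P[B6 ga6 d16 d26 _]].
have gi x y : x < 6 -> y < 6 -> g x = g y -> x = y.
  by move=> x6 y6 E; rewrite -(fg x) // E fg.
have pq : port_colors (map g [:: B; ga; d1; d2]).
  apply/and3P; split=> //; last by rewrite /= !(proj2 (f6 _ _)).
  rewrite map_inj_in_uniq // => x y; rewrite !inE => /or4P[]/eqP-> /or4P[]/eqP->;
    exact: gi.
have [be [de [vu [vw [uv [uw [wu [wv [cU [cV [cW []]]]]]]]]]]] :=
  triangle_searchP (all_portsP triangle_search_ports pq).
move=> hbe hde /and3P[lV lU lW].
exists (f be), (f de), (f vu), (f vw), (f uv), (f uw), (f wu), (f wv), (f cU), (f cV), (f cW).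
have m := @local_map f _ _ _ _ inj (fun x x6 => proj1 (f6 x x6)).
have l6 c nc o i : local c nc o i -> c < 6 by case/andP=> /and4P[/andP[]].
have [U6 V6 W6] := And3 (l6 _ _ _ _ lU) (l6 _ _ _ _ lV) (l6 _ _ _ _ lW).
split; first by rewrite -map_drop map_f.
  have : f de \in map f (drop 2 (map g [:: B; ga; d1; d2])) by apply: map_f.
  by rewrite /= !fg.
apply/and3P; split.
- by have := m _ _ _ _ _ lV; rewrite /= U6 W6 => /(_ isT).
- by have := m _ _ _ _ _ lU; rewrite /= V6 W6 => /(_ isT).
- by have := m _ _ _ _ _ lW; rewrite /= U6 V6 (proj2 (f6 B B6)) !fg // => /(_ isT).
Qed.

Definition edge_ext p q be de x y cU cV :=
  local cU [:: nth 0 p 0; cV] [:: be; x] [:: nth 0 p 1; y] &&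
  local cV [:: nth 0 q 0; cU] [:: de; y] [:: nth 0 q 1; x].

Lemma edge_extension p q : port_colors p -> port_colors q ->
  exists be de x y cU cV, [/\ be \in drop 2 p, de \in drop 2 q
    & edge_ext p q be de x y cU cV].
Proof.
move=> pp; have [f [g [-> inj f6 fg]]] := normalise_port pp.
case: q => [|B [|ga [|d1 [|d2 [|]]]]] // /and3P[_ uq /and5P[B6 ga6 d16 d26 _]].
have gi x y : x < 6 -> y < 6 -> g x = g y -> x = y.
  by move=> x6 y6 E; rewrite -(fg x) // E fg.
have pq : port_colors (map g [:: B; ga; d1; d2]).
  apply/and3P; split=> //; last by rewrite /= !(proj2 (f6 _ _)).
  rewrite map_inj_in_uniq // => x y; rewrite !inE => /or4P[]/eqP-> /or4P[]/eqP->;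
    exact: gi.
have := all_portsP edge_search_ports pq.
case/someP=> be hbe /someP[de hde] /someP[x _]; case: ifP => // _.
case/someP=> y _; case: ifP => // _ /someP[cU _]; case: ifP => // _.
case/someP=> cV _ /andP[lU lV].
exists (f be), (f de), (f x), (f y), (f cU), (f cV).
have m := @local_map f _ _ _ _ inj (fun x x6 => proj1 (f6 x x6)).
have l6 c nc o i : local c nc o i -> c < 6 by case/andP=> /and4P[/andP[]].
have [U6 V6] := conj (l6 _ _ _ _ lU) (l6 _ _ _ _ lV).
split; first by rewrite -map_drop map_f.
  have : f de \in map f (drop 2 (map g [:: B; ga; d1; d2])) by apply: map_f.
  by rewrite /= !fg.
apply/andP; split.
- by have := m _ _ _ _ _ lU; rewrite /= V6 => /(_ isT).
- by have := m _ _ _ _ _ lV; rewrite /= U6 (proj2 (f6 B B6)) !fg // => /(_ isT).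
Qed.

(** Here v and w share their outer neighbour, of colour [c]. Their incidences on the edges to it get
    one colour [be], since its I2 set shows at most two colours; the ports are cut to three entries,
    which forces [be]. *)
Definition diamond_search c outs ins :=
  some (fun al => some (fun ga => some (fun be =>
    if star c [:: al, ga & outs] [:: be, be & ins]
    then triangle_search [:: c; al; be] [:: c; ga; be] else false) cols) cols) cols.

Lemma diamond_search1 : all (fun c => all (fun o => all (fun i =>
  if star c [:: o] [:: i] then diamond_search c [:: o] [:: i] else true)
  cols) cols) cols.
Proof. by vm_compute. Qed.

Lemma diamond_search0 : all (fun c => diamond_search c [::] [::]) cols.
Proof. by vm_compute. Qed.

Lemma diamond_extension c outs ins : star c outs ins ->
  size outs <= 1 -> size ins = size outs ->
  exists al ga be, star c [:: al, ga & outs] [:: be, be & ins] /\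
  exists vu vw uv uw wu wv cU cV cW,
    triangle_ext [:: c; al] [:: c; ga] be be vu vw uv uw wu wv cU cV cW.
Proof.
move=> st s2 sz; have : diamond_search c outs ins.
  have := st => /and4P[/= + _ _ _]; rewrite all_cat.
  case: outs ins sz s2 st => [|o1 [|]] [|i1 [|]] //= _ _ st.
  - by rewrite andbT => c6; exact: (colsP diamond_search0).
  - rewrite !andbT => /and3P[c6 o6 i6].
    by have := colsP (colsP (colsP diamond_search1 c6) o6) i6; rewrite st.
case/someP=> al _ /someP[ga _ /someP[be _]]; case: ifP => // {}st.
case/triangle_searchP=> b1 [b2 [vu [vw [uv [uw [wu [wv [cU [cV [cW []]]]]]]]]]].
rewrite /= !inE => /eqP-> /eqP-> ext; exists al, ga, be; split=> //.
by exists vu, vw, uv, uw, wu, wv, cU, cV, cW.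
Qed.

Definition pendant_search p :=
  some (fun cU => local cU [:: nth 0 p 0] [:: nth 0 p 2] [:: nth 0 p 1]) cols.

Lemma pendant_search_ports : all_ports pendant_search.
Proof. by vm_compute. Qed.
End Local.

(** * Extending colourings *)

Section Coloring.
Local Open Scope set_scope.
Variable G : sgraph.
Hypothesis deg3 : forall v : G, #|neighbours v| <= 3.
Implicit Types (S : {set G}) (cv : G -> nat) (ca : G -> G -> nat) (ds : seq G).

(* ca v w is the colour of the incidence (v, {v, w}). *)
Definition local_on cv ca (v : G) (s : seq G) :=
  local (cv v) [seq cv w | w <- s] [seq ca v w | w <- s] [seq ca w v | w <- s].

Definition colored S cv ca :=
  forall v, v \in S -> local_on cv ca v (enum (neighbours v :&: S)).

Lemma local_on_enum S cv ca v s : uniq s -> s =i neighbours v :&: S ->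
  local_on cv ca v (enum (neighbours v :&: S)) = local_on cv ca v s.
Proof.
move=> us sE; apply: local_perm; apply: uniq_perm => //; first exact: enum_uniq.
by move=> x; rewrite mem_enum sE.
Qed.

Definition rest S ds : {set G} := S :\: [set x in ds].

Definition outs S ca y := [seq ca y w | w <- enum (neighbours y :&: S)].
Definition ins S ca y := [seq ca w y | w <- enum (neighbours y :&: S)].

Lemma uniq_rest S ds y (s := [seq d <- ds | adj y d] ++ enum (neighbours y :&: rest S ds)) :
  uniq ds -> {subset ds <= S} -> uniq s /\ s =i neighbours y :&: S.
Proof.
move=> uds dsS; split.
  rewrite cat_uniq filter_uniq // enum_uniq andbT; apply/hasPn => x.
  rewrite mem_enum !inE => /and3P[_ + _]; apply: contra.
  by rewrite mem_filter => /andP[].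
move=> x; rewrite mem_cat mem_filter mem_enum !inE.
by case: (boolP (x \in ds)) => [/dsS->|]; rewrite ?andbF ?orbF ?andbT.
Qed.

(** Constraints at a vertex involve only its neighbours and edges. A kept vertex away from [ds]
    inherits them; one next to [ds] needs a check of its enlarged star and of its colour against the
    new vertices. *)
Lemma extend_coloring S ds cv ca cv' ca' : uniq ds -> {subset ds <= S} ->
  colored (rest S ds) cv ca ->
  {in rest S ds, cv' =1 cv} -> {in rest S ds &, ca' =2 ca} ->
  (forall x, x \in ds -> local_on cv' ca' x (enum (neighbours x :&: S))) ->
  (forall y (d := [seq d <- ds | adj y d]), y \in rest S ds -> d != [::] ->
     star (cv y) ([seq ca' y x | x <- d] ++ outs (rest S ds) ca y)
                 ([seq ca' x y | x <- d] ++ ins (rest S ds) ca y) /\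
     cv y \notin [seq cv' x | x <- d]) ->
  colored S cv' ca'.
Proof.
move=> uds dsS col ecv eca okd oky y yS.
have [/okd//|yds] := boolP (y \in ds).
have yR : y \in rest S ds by rewrite !inE yds.
have [us sE] := uniq_rest y uds dsS; rewrite (local_on_enum _ _ us sE).
have sR w : w \in enum (neighbours y :&: rest S ds) -> w \in rest S ds.
  by rewrite mem_enum inE => /andP[].
rewrite /local_on !map_cat ecv //.
have -> : [seq ca' y w | w <- enum (neighbours y :&: rest S ds)] = outs (rest S ds) ca y.
  by apply/eq_in_map => w /sR wR; apply: eca.
have -> : [seq ca' w y | w <- enum (neighbours y :&: rest S ds)] = ins (rest S ds) ca y.
  by apply/eq_in_map => w /sR wR; apply: eca.
have -> : [seq cv' w | w <- enum (neighbours y :&: rest S ds)] =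
          [seq cv w | w <- enum (neighbours y :&: rest S ds)].
  by apply/eq_in_map => w /sR wR; apply: ecv.
have /andP[sy ny] := col y yR.
have [->|/(oky y yR)[st cn]] := eqVneq [seq d <- ds | adj y d] [::].
  by rewrite /local sy ny.
by rewrite /local st mem_cat negb_or cn ny.
Qed.

(** [o] holds the possible outer neighbour beyond the known [l]; it comes first so that
    [local_behead] applies when it is absent. *)
Lemma nbr_list S x (l : seq G) : uniq l -> {subset l <= neighbours x :&: S} ->
  degree S x <= (size l).+1 ->
  exists o, [/\ size o <= 1, uniq (o ++ l) & o ++ l =i neighbours x :&: S].
Proof.
move=> ul lN; pose o := [seq y <- enum (neighbours x :&: S) | y \notin l].
have uo : uniq (o ++ l).
  rewrite cat_uniq filter_uniq ?enum_uniq // ul andbT; apply/hasPn => y yl.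
  by rewrite mem_filter yl.
have oE : o ++ l =i neighbours x :&: S.
  move=> y; rewrite mem_cat mem_filter mem_enum.
  by case: (boolP (y \in l)) => [/lN->|_]; rewrite ?orbF.
move=> h; exists o; split=> //.
have := card_uniqP uo; rewrite (eq_card oE) -/(degree S x) size_cat => E.
by rewrite E in h; move: h; clear; lia.
Qed.

Lemma degree_le3 S x : degree S x <= 3.
Proof. by apply: leq_trans (deg3 x); apply/subset_leq_card/subsetIl. Qed.

(** Bounds the number of old neighbours as [port_exists] and [diamond_extension] require. *)
Lemma size_rest S ds y : uniq ds -> {subset ds <= S} ->
  size [seq d <- ds | adj y d] + degree (rest S ds) y <= 3.
Proof.
move=> uds dsS; have [us sE] := uniq_rest y uds dsS.
by rewrite /degree cardE -size_cat -(card_uniqP us) (eq_card sE) degree_le3.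
Qed.

Lemma size_outs S ca y : size (outs S ca y) = degree S y.
Proof. by rewrite size_map -cardE. Qed.

Lemma size_ins S ca y : size (ins S ca y) = degree S y.
Proof. by rewrite size_map -cardE. Qed.

(* A port lists the colour of y, a colour for the incidence leading from y to
   a new neighbour and two possible colours for the one coming back; when o is
   empty the new neighbour has no old neighbour and the port is arbitrary. *)
Lemma port_opt S ds cv ca (o : seq G) : uniq ds -> {subset ds <= S} ->
  colored (rest S ds) cv ca -> size o <= 1 -> {subset o <= rest S ds} ->
  (forall y, y \in o -> has (adj y) ds) ->
  exists p, port_colors p /\ forall y, y \in o -> nth 0 p 0 = cv y /\
    forall be, be \in drop 2 p ->
    star (cv y) (nth 0 p 1 :: outs (rest S ds) ca y) (be :: ins (rest S ds) ca y).
Proof.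
move=> uds dsS col; case: o => [|y [|]] // _ oR oD; first by exists (iota 0 4).
have yR := oR y (mem_head _ _); have hy := oD y (mem_head _ _).
have /andP[sy _] := col y yR.
have dy : degree (rest S ds) y <= 2.
  rewrite -ltnS; apply: leq_trans (size_rest y uds dsS).
  by rewrite -add1n leq_add2r size_filter -has_count.
have [||al [b1 [b2 [p6 up s1 s2]]]] := port_exists sy.
- by rewrite size_outs.
- by rewrite size_outs size_ins.
exists [:: cv y; al; b1; b2]; split; first by apply/and3P.
move=> z; rewrite inE => /eqP->; split=> // be.
by rewrite !inE => /orP[]/eqP->.
Qed.

Lemma neq_sym2 (T : eqType) (x y : T) : x != y ->
  ((x == y) = false) * ((y == x) = false).
Proof. by move=> /negPf xy; split; rewrite // eq_sym. Qed.

Lemma pendant_step S u cv ca : u \in S -> degree S u <= 1 ->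
  colored (rest S [:: u]) cv ca -> exists cv' ca', colored S cv' ca'.
Proof.
move=> uS du col; have uds : uniq [:: u] by [].
have dsS : {subset [:: u] <= S} by move=> x; rewrite inE => /eqP->.
have [|//|o [so uo oE]] := @nbr_list S u [::] isT; first by [].
rewrite cats0 in uo oE.
have oN x : (x \in o) = adj u x && (x \in S) by rewrite oE !inE.
have oR : {subset o <= rest S [:: u]}.
  move=> x; rewrite oN !inE => /andP[ux ->]; rewrite andbT.
  by apply: contraTneq ux => ->; rewrite adj_irr.
have oD y : y \in o -> has (adj y) [:: u] by rewrite oN /= adj_sym => /andP[->].
have [p [pp hp]] := port_opt uds dsS col so oR oD.
have /someP[cU _ lU] := all_portsP pendant_search_ports pp.
have p2 : nth 0 p 2 \in drop 2 p.
  by case/and3P: pp => /eqP; case: (p) => [|? [|? [|? [|? [|]]]]] //= _; rewrite mem_head.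
exists (fun x => if x == u then cU else cv x).
exists (fun x y => if x == u then nth 0 p 2 else if y == u then nth 0 p 1 else ca x y).
have nu y : y \in rest S [:: u] -> (y == u) = false by rewrite !inE => /andP[/negPf].
apply: (extend_coloring uds dsS col).
- by move=> x /nu->.
- by move=> x y /nu-> /nu->.
- move=> x; rewrite inE => /eqP->; rewrite (local_on_enum _ _ uo oE).
  rewrite /local_on eqxx; case: (o) so hp oR => [|y [|]] //= _.
    by move=> _ _; apply: local_behead lU.
  move=> /(_ y (mem_head _ _))[<- _] /(_ y (mem_head _ _))/nu ->.
  exact: lU.
- move=> y /=; case: ifP => // yu yR _ /=; rewrite eqxx nu //.
  have yo : y \in o by move: yR; rewrite oN !inE adj_sym yu => /andP[].
  have [p0 st] := hp y yo; split; first exact: st.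
  rewrite inE; case/andP: lU => _; rewrite inE p0; by rewrite eq_sym.
Qed.

Lemma nbr_list_eq S x (l : seq G) : uniq l -> {subset l <= neighbours x :&: S} ->
  degree S x = size l -> l =i neighbours x :&: S.
Proof.
move=> ul lN dl; have [|[|y o] [so uo oE]] := nbr_list ul lN; rewrite ?dl //.
have := card_uniqP uo; rewrite (eq_card oE) -/(degree S x) dl /= size_cat.
by rewrite -addSn => /eqP; rewrite -{1}[size l]add0n eqn_add2r.
Qed.

(** Identifies the kept vertices adjacent to a removed [v], so that the filter in [extend_coloring]
    can be evaluated. *)
Lemma other_nbrs S ds v o l : o ++ l =i neighbours v :&: S -> {subset l <= ds} ->
  uniq (o ++ l) -> (forall x, x \in ds -> x \in v :: l) -> v \in ds ->
  {subset o <= rest S ds} /\ {in rest S ds, forall y, adj y v = (y \in o)}.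
Proof.
move=> oE lds uo dsl vds.
have oN x : x \in o -> adj v x && (x \in S).
  by move=> xo; have := oE x; rewrite mem_cat xo !inE.
split=> [x xo|y yR].
  have /andP[vx xS] := oN x xo; rewrite !inE xS andbT.
  apply/negP => /dsl; rewrite inE => /orP[/eqP xv|xl].
    by rewrite xv adj_irr in vx.
  by move: uo; rewrite cat_uniq => /and3P[_ /hasPn/(_ x xl)]; rewrite /= xo.
apply/idP/idP => [yv|/oN/andP[]]; last by rewrite adj_sym.
move: yR; rewrite !inE => /andP[yds yS].
have : y \in o ++ l by rewrite oE !inE adj_sym yv.
by rewrite mem_cat => /orP[//|/lds]; rewrite (negPf yds).
Qed.

Lemma triangle_step S u v w cv ca : u \in S -> v \in S -> w \in S ->
  adj u v -> adj u w -> adj v w -> degree S u = 2 ->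
  colored (rest S [:: u; v; w]) cv ca -> exists cv' ca', colored S cv' ca'.
Proof.
move=> uS vS wS uv uw vw du col.
have [vu wu wv] : [/\ adj v u, adj w u & adj w v].
  by split; rewrite adj_sym.
have nq (x y : G) : adj x y -> x != y by apply: contraTneq => ->; rewrite adj_irr.
have [Euv Euw Evw] := And3 (neq_sym2 (nq _ _ uv)) (neq_sym2 (nq _ _ uw))
  (neq_sym2 (nq _ _ vw)).
set ds := [:: u; v; w] in col *.
have uds : uniq ds by rewrite /= !inE Euv Euw Evw.
have dsS : {subset ds <= S} by move=> x; rewrite !inE => /or3P[]/eqP->.
have uE : [:: v; w] =i neighbours u :&: S.
  apply: nbr_list_eq; rewrite //= ?inE ?Evw // => x.
  by rewrite !inE => /orP[]/eqP->; rewrite ?uv ?uw ?vS ?wS.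
have [|||ov [sov uov ovE]] := @nbr_list S v [:: u; w].
- by rewrite /= inE Euw.
- by move=> x; rewrite !inE => /orP[]/eqP->; rewrite ?vu ?vw ?uS ?wS.
- exact: degree_le3.
have [|||ow [sow uow owE]] := @nbr_list S w [:: u; v].
- by rewrite /= inE Euv.
- by move=> x; rewrite !inE => /orP[]/eqP->; rewrite ?wu ?wv ?uS ?vS.
- exact: degree_le3.
have [|||ovR ovA] := @other_nbrs S ds v ov [:: u; w] ovE _ uov.
- by move=> x; rewrite !inE => /orP[]->; rewrite ?orbT.
- by move=> x; rewrite !inE => /or3P[]->; rewrite ?orbT.
- by rewrite !inE eqxx orbT.
have [|||owR owA] := @other_nbrs S ds w ow [:: u; v] owE _ uow.
- by move=> x; rewrite !inE => /orP[]->; rewrite ?orbT.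
- by move=> x; rewrite !inE => /or3P[]->; rewrite ?orbT.
- by rewrite !inE eqxx !orbT.
have uA y : y \in rest S ds -> adj y u = false.
  rewrite !inE !negb_or => /andP[/and3P[_ /negPf yv /negPf yw] yS].
  by have := uE y; rewrite !inE yv yw yS andbT adj_sym => <-.
have nR y : y \in rest S ds -> ((y == u) = false) * ((y == v) = false) * ((y == w) = false).
  by rewrite !inE !negb_or => /andP[/and3P[/negPf-> /negPf-> /negPf->] _].
(* The outer neighbours of [v] and [w] may be absent, distinct or equal; the match on memberships
   treats all cases at once. *)
have assemble p q be de vu0 vw0 uv0 uw0 wu0 wv0 cU cV cW :
    triangle_ext p q be de vu0 vw0 uv0 uw0 wu0 wv0 cU cV cW ->
    {in ov, forall x, nth 0 p 0 = cv x} -> {in ow, forall x, nth 0 q 0 = cv x} ->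
    {in rest S ds, forall y (o := outs (rest S ds) ca y) (i := ins (rest S ds) ca y),
      match y \in ov, y \in ow with
      | true, true => star (cv y) [:: nth 0 p 1, nth 0 q 1 & o] [:: be, de & i]
      | true, false => star (cv y) (nth 0 p 1 :: o) (be :: i)
      | false, true => star (cv y) (nth 0 q 1 :: o) (de :: i)
      | _, _ => true end} ->
    exists cv' ca', colored S cv' ca'.
  case/and3P=> lV lU lW hp hq st.
  exists (fun x => if x == u then cU else if x == v then cV else if x == w then cW else cv x).
  exists (fun x y => if x == u then if y == v then uv0 else uw0
    else if x == v then if y == u then vu0 else if y == w then vw0 else be
    else if x == w then if y == u then wu0 else if y == v then wv0 else de
    else if y == v then nth 0 p 1 else if y == w then nth 0 q 1 else ca x y).
  apply: (extend_coloring uds dsS col).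
  - by move=> x /nR xR; rewrite !xR.
  - by move=> x y /nR xR /nR yR; rewrite !xR !yR.
  - move=> x; rewrite !inE => /or3P[]/eqP->.
    + rewrite (local_on_enum _ _ _ uE) /= ?inE ?Evw //.
      by rewrite /local_on /= !eqxx !Euv !Euw !Evw.
    + rewrite (local_on_enum _ _ uov ovE).
      case: (ov) sov hp ovR => [|y [|]] // _ hp oR; rewrite /local_on /=.
        by rewrite !eqxx !Euv !Euw !Evw; apply: local_behead lV.
      have yR := nR y (oR y (mem_head _ _)).
      by rewrite !eqxx !Euv !Euw !Evw !yR -(hp y) ?mem_head.
    + rewrite (local_on_enum _ _ uow owE).
      case: (ow) sow hq owR => [|y [|]] // _ hq oR; rewrite /local_on /=.
        by rewrite !eqxx !Euv !Euw !Evw; apply: local_behead lW.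
      have yR := nR y (oR y (mem_head _ _)).
      by rewrite !eqxx !Euv !Euw !Evw !yR -(hq y) ?mem_head.
  - move=> y /= yR; have := st y yR; rewrite (uA y yR) (ovA y yR) (owA y yR).
    have nV : y \in ov -> cv y != cV.
      by case/andP: lV => _ + /hp <-; rewrite inE negb_or eq_sym => /andP[].
    have nW : y \in ow -> cv y != cW.
      by case/andP: lW => _ + /hq <-; rewrite inE negb_or eq_sym => /andP[].
    case: (boolP (y \in ov)) => [/nV yv|_]; case: (boolP (y \in ow)) => [/nW yw|_] //= h _;
    by rewrite !(nR y yR, eqxx, Euv, Euw, Evw) !inE ?(negPf yv) ?(negPf yw).
(* A common outer neighbour [y] has at most one old neighbour, so [diamond_extension] applies. *)
case: (boolP (has (mem ov) ow)) => [/hasP[y yw /= yv]|dis].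
  have yR := ovR y yv; have /andP[sy _] := col y yR.
  have dy : degree (rest S ds) y <= 1.
    have := size_rest y uds dsS; rewrite /= (uA y yR) (ovA y yR) (owA y yR) yv yw /=.
    by rewrite !add2n.
  have [||al [ga [be [st [vu0 [vw0 [uv0 [uw0 [wu0 [wv0 [cU [cV [cW ext]]]]]]]]]]]]] :=
    diamond_extension sy; rewrite ?size_outs ?size_ins //.
  have one (o : seq G) x : size o <= 1 -> y \in o -> x \in o -> x = y.
    by case: o => [|z [|]] //= _; rewrite !inE => /eqP-> /eqP->.
  apply: (assemble _ _ _ _ _ _ _ _ _ _ _ _ _ ext) => [x xo|x xo|x xR] /=.
  - by rewrite (one _ _ sov yv xo).
  - by rewrite (one _ _ sow yw xo).
  - case: (boolP (x \in ov)) => [xo|xv]; first by rewrite (one _ _ sov yv xo) yw.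
    by case: (boolP (x \in ow)) => // xo; rewrite (one _ _ sow yw xo) yv in xv.
(* Without a common outer neighbour the two ports are independent. *)
have [|p [pp hp]] := port_opt uds dsS col sov ovR.
  by move=> y yo; apply/hasP; exists v; rewrite ?inE ?eqxx ?orbT // ovA // ovR.
have [|q [pq hq]] := port_opt uds dsS col sow owR.
  by move=> y yo; apply/hasP; exists w; rewrite ?inE ?eqxx ?orbT // owA // owR.
have [be [de [vu0 [vw0 [uv0 [uw0 [wu0 [wv0 [cU [cV [cW [hbe hde ext]]]]]]]]]]]] :=
  triangle_extension pp pq.
apply: (assemble _ _ _ _ _ _ _ _ _ _ _ _ _ ext) => [x /hp[]//|x /hq[]//|y yR] /=.
case: (boolP (y \in ov)) => yv; case: (boolP (y \in ow)) => yw //.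
- by case/hasP: dis; exists y.
- by have [_] := hp y yv; apply.
- by have [_] := hq y yw; apply.
Qed.

End Coloring.

(** * Induction on vertex sets and passage to (6,2)-colourings *)

Section Colorable.
Local Open Scope set_scope.
Variable G : sgraph.
Hypothesis deg3 : forall v : G, #|neighbours v| <= 3.
Implicit Types (S : {set G}) (cv : G -> nat) (ca : G -> G -> nat) (ds : seq G).

(** A common neighbour would gain two edges at once and its two ports would interfere; that
    configuration is a triangle, left to [triangle_step]. *)
Lemma edge_step S u v cv ca : u \in S -> v \in S -> adj u v ->
  degree S u = 2 -> degree S v = 2 ->
  (forall x, x \in S -> adj u x -> adj v x -> False) ->
  colored (rest S [:: u; v]) cv ca -> exists cv' ca', colored S cv' ca'.
Proof.
move=> uS vS uv du dv nocommon col.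
have vu : adj v u by rewrite adj_sym.
have Euv : ((u == v) = false) * ((v == u) = false).
  by apply: neq_sym2; apply: contraTneq uv => ->; rewrite adj_irr.
set ds := [:: u; v] in col *.
have uds : uniq ds by rewrite /= !inE Euv.
have dsS : {subset ds <= S} by move=> x; rewrite !inE => /orP[]/eqP->.
have [|||ou [sou uou ouE]] := @nbr_list G S u [:: v] => //.
- by move=> x; rewrite !inE => /eqP->; rewrite uv vS.
- by rewrite du.
have [|||ov [sov uov ovE]] := @nbr_list G S v [:: u] => //.
- by move=> x; rewrite !inE => /eqP->; rewrite vu uS.
- by rewrite dv.
have [|||ouR ouA] := @other_nbrs G S ds u ou [:: v] ouE _ uou.
- by move=> x; rewrite !inE => ->; rewrite orbT.
- by move=> x; rewrite !inE.
- by rewrite !inE eqxx.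
have [|||ovR ovA] := @other_nbrs G S ds v ov [:: u] ovE _ uov.
- by move=> x; rewrite !inE => ->.
- by move=> x; rewrite !inE => /orP[]->; rewrite ?orbT.
- by rewrite !inE eqxx orbT.
have [|p [pp hp]] := port_opt deg3 uds dsS col sou ouR.
  by move=> y yo; apply/hasP; exists u; rewrite ?inE ?eqxx // ouA // ouR.
have [|q [pq hq]] := port_opt deg3 uds dsS col sov ovR.
  by move=> y yo; apply/hasP; exists v; rewrite ?inE ?eqxx ?orbT // ovA // ovR.
have nR y : y \in rest S ds -> ((y == u) = false) * ((y == v) = false).
  by rewrite !inE !negb_or => /andP[/andP[/negPf-> /negPf->] _].
have [be [de [x0 [y0 [cU [cV [hbe hde /andP[lU lV]]]]]]]] := edge_extension pp pq.
exists (fun x => if x == u then cU else if x == v then cV else cv x).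
exists (fun x y => if x == u then if y == v then x0 else be
  else if x == v then if y == u then y0 else de
  else if y == u then nth 0 p 1 else if y == v then nth 0 q 1 else ca x y).
apply: (extend_coloring uds dsS col).
- by move=> x /nR xR; rewrite !xR.
- by move=> x y /nR xR /nR yR; rewrite !xR !yR.
- move=> x; rewrite !inE => /orP[]/eqP->.
  + rewrite (local_on_enum _ _ uou ouE).
    case: (ou) sou hp ouR => [|y [|]] // _ hp oR; rewrite /local_on /=.
      by rewrite !eqxx !Euv; apply: local_behead lU.
    have yR := nR y (oR y (mem_head _ _)).
    have [hy _] := hp y (mem_head _ _).
    by rewrite !eqxx !Euv !yR -hy.
  + rewrite (local_on_enum _ _ uov ovE).
    case: (ov) sov hq ovR => [|y [|]] // _ hq oR; rewrite /local_on /=.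
      by rewrite !eqxx !Euv; apply: local_behead lV.
    have yR := nR y (oR y (mem_head _ _)).
    have [hy _] := hq y (mem_head _ _).
    by rewrite !eqxx !Euv !yR -hy.
- move=> y /= yR; rewrite (ouA y yR) (ovA y yR).
  have nU : y \in ou -> cv y != cU.
    by case/andP: lU => _ + /hp[<- _]; rewrite inE negb_or eq_sym => /andP[].
  have nV : y \in ov -> cv y != cV.
    by case/andP: lV => _ + /hq[<- _]; rewrite inE negb_or eq_sym => /andP[].
  case: (boolP (y \in ou)) => yu; case: (boolP (y \in ov)) => yv //= _.
  + exfalso; move: yu yv; rewrite -(ouA y yR) -(ovA y yR) ![adj y _]adj_sym.
    by apply: nocommon; move: yR; rewrite inE => /andP[].
  + rewrite !(nR y yR, eqxx, Euv) !inE (negPf (nU yu)).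
    by have [_ /(_ be hbe)] := hp y yu.
  + rewrite !(nR y yR, eqxx, Euv) !inE (negPf (nV yv)).
    by have [_ /(_ de hde)] := hq y yv.
Qed.

Hypothesis reducibleG : forall S, S != set0 ->
  (forall v, v \in S -> 1 < degree S v) -> reducible S.

Lemma coloring_exists S : exists cv ca, colored S cv ca.
Proof.
have [n] := ubnP #|S|; elim: n S => // n IH S; rewrite ltnS => Sn.
have IHrest u ds : u \in S -> u \in ds -> exists cv ca, colored (rest S ds) cv ca.
  move=> uS uds; apply: IH; apply: leq_trans Sn; apply: proper_card.
  rewrite properE subsetDl; apply/subsetPn; exists u => //; by rewrite !inE uds.
have tri u v w : u \in S -> v \in S -> w \in S ->
  adj u v -> adj u w -> adj v w -> degree S u = 2 -> exists cv ca, colored S cv ca.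
  move=> uS vS wS uv uw vw du; have [cv [ca col]] := IHrest u [:: u; v; w] uS (mem_head _ _).
  exact: (triangle_step deg3 uS vS wS uv uw vw du col).
have [->|S0] := eqVneq S set0.
  by exists (fun=> 0), (fun _ _ => 0) => v; rewrite inE.
case: (boolP [exists u in S, degree S u <= 1]) => [/existsP[u /andP[uS du]]|].
  have [cv [ca col]] := IHrest u [:: u] uS (mem_head _ _).
  exact: (pendant_step deg3 uS du col).
rewrite negb_exists_in => /forall_inP hdeg.
case: (reducibleG S0) =>
  [v /hdeg|[u [v [uS vS uv du dv]]]|[u [v [w [/and3P[uS vS wS] uv uw vw du]]]]].
- by rewrite -ltnNge.
(* Adjacent vertices of degree 2 with a common neighbour form a reducible triangle. *)
- case: (boolP [exists x in S, adj u x && adj v x]) => [/existsP[x /and3P[xS ux vx]]|].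
    exact: (tri u v x).
  rewrite negb_exists_in => /forall_inP nc.
  have [cv [ca col]] := IHrest u [:: u; v] uS (mem_head _ _).
  apply: (edge_step uS vS uv du dv _ col) => x xS ux vx.
  by have := nc x xS; rewrite ux vx.
- exact: (tri u v w).
Qed.

(** The default is never taken: by [incidenceE] the edge has a second end. *)
Definition other_end (i : incidence G) : G :=
  odflt (inc_vertex i) [pick w in inc_edge i :\ inc_vertex i].

Lemma incidenceE (i : incidence G) : adj (inc_vertex i) (other_end i) /\
  inc_edge i = [set inc_vertex i; other_end i].
Proof.
have /andP[+ iv] := valP i; rewrite inE => /existsP[a /existsP[b /andP[ab /eqP E]]].
have ne : a != b by apply: contraTneq ab => ->; rewrite adj_irr.
rewrite /other_end /inc_edge /inc_vertex E; move: iv; rewrite E !inE.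
case/orP=> /eqP->; case: pickP => [w|/= h] /=.
- rewrite !inE => /andP[/negPf wa]; rewrite wa /= => /eqP->; by split.
- by have := h b; rewrite !inE eqxx eq_sym ne orbT.
- rewrite !inE => /andP[/negPf wb]; rewrite wb orbF => /eqP->.
  by split; [rewrite adj_sym|rewrite setUC].
- by have := h a; rewrite !inE eqxx ne.
Qed.

Lemma inc_other (i : incidence G) w : inc_vertex i != w ->
  inc_edge i = [set inc_vertex i; w] -> other_end i = w.
Proof.
move=> iw; have [io ->] := incidenceE i => /setP/(_ w).
by rewrite !inE eqxx orbT eq_sym (negPf iw) /= => /eqP.
Qed.

Lemma inc_inj (i j : incidence G) :
  inc_vertex i = inc_vertex j -> other_end i = other_end j -> i = j.
Proof.
move=> vij oij; apply: val_inj.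
have [_ ei] := incidenceE i; have [_ ej] := incidenceE j.
have : inc_edge i = inc_edge j by rewrite ei ej vij oij.
by move: vij; rewrite /inc_vertex /inc_edge; case: (val i) (val j) => [? ?] [? ?] /= -> ->.
Qed.

Lemma third_adj_inc (i j : incidence G) : third_adj (inr i) (inr j) ->
  inc_vertex j = other_end i /\ other_end j = inc_vertex i.
Proof.
case/andP=> /eqP eij nij; have [_ ei] := incidenceE i; have [_ ej] := incidenceE j.
have h : inc_vertex j = other_end i.
  have /setP/(_ (inc_vertex j)) := eij; rewrite ei ej.
  by rewrite !inE eqxx eq_sym (negPf nij) /= => /eqP->.
split=> //; apply: inc_other; first by rewrite eq_sym.
by rewrite -eij ei h setUC.
Qed.

Lemma uniq_map_inj (T U : eqType) (f : T -> U) (s : seq T) :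
  uniq (map f s) -> {in s &, injective f}.
Proof.
elim: s => //= a s IH /andP[fa us] x y; rewrite !inE.
case/predU1P=> [->|xs]; case/predU1P=> [->|ys] // E.
- by rewrite E map_f in fa.
- by rewrite -E map_f in fa.
- exact: IH.
Qed.

(** A walk of length at most 3 between distinct elements relates a vertex to its own incidence
    ([F1]), to the far incidence of one of its edges ([F2]) or to a neighbour ([F3]), or else two
    incidences at one vertex ([F4]), or (v, vw) and (w', w'v) ([F5]). Each is a clause of [local] at
    v, and so is the bound on I2(v). *)
Lemma colored_ks cv ca : colored [set: G] cv ca -> ks_colorable G 2 6.
Proof.
move=> col; have mN (v w : G) : adj v w -> w \in enum (neighbours v :&: [set: G]).
  by move=> vw; rewrite mem_enum !inE vw.
have loc (v : G) := andP (col v (in_setT v)).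
have cv6 v : cv v < 6 by have [/and4P[/andP[]]] := loc v.
have ca6 v w : adj v w -> ca v w < 6.
  move=> vw; have [/and4P[/allP h _ _ _] _] := loc v; apply: h.
  by rewrite inE mem_cat (map_f (ca v) (mN _ _ vw)) orbT.
have F1 v w : adj v w -> cv v != ca v w.
  move=> vw; have [/and4P[_ /andP[+ _] _ _] _] := loc v; apply: contraNneq => ->.
  exact: (map_f (ca v) (mN _ _ vw)).
have F5 v w w' : adj v w -> adj v w' -> ca v w != ca w' v.
  move=> vw vw'; have [/and4P[_ _ /allP h _] _] := loc v.
  have := h _ (map_f (ca^~ v) (mN _ _ vw')); apply: contraNneq => <-.
  by rewrite inE (map_f (ca v) (mN _ _ vw)) orbT.
have F2 v w : adj v w -> cv v != ca w v.
  move=> vw; have [/and4P[_ _ /allP h _] _] := loc v.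
  have := h _ (map_f (ca^~ v) (mN _ _ vw)); apply: contraNneq => <-; exact: mem_head.
have F3 v w : adj v w -> cv v != cv w.
  move=> vw; have [_ ] := loc v; apply: contraNneq => ->; exact: (map_f cv (mN _ _ vw)).
have F4 v w w' : adj v w -> adj v w' -> w != w' -> ca v w != ca v w'.
  move=> vw vw'; have [/and4P[_ /andP[_ u] _ _] _] := loc v.
  by apply: contraNneq => E; apply/eqP; apply: (uniq_map_inj u) E; apply: mN.
pose c (x : G + incidence G) : nat :=
  match x with inl v => cv v | inr i => ca (inc_vertex i) (other_end i) end.
have c6 x : c x < 6.
  by case: x => [v|i] /=; [exact: cv6|apply: ca6; have [] := incidenceE i].
exists (fun x => inord (c x)); split; last first.
  move=> v; have [/and4P[_ _ _ sz] _] := loc v; apply: leq_trans sz.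
  set l := undup _; apply: leq_trans (_ : #|[set y in [seq inord x : 'I_6 | x <- l]]| <= _).
    apply/subset_leq_card/subsetP => _ /imsetP[i iI ->]; rewrite inE; apply: map_f.
    move: iI; rewrite !inE => /andP[vi /eqP ei]; rewrite mem_undup /=.
    have -> : other_end i = v.
      by apply: inc_other => //; apply: contraTneq vi => ->; rewrite adj_irr.
    exact: (map_f (ca^~ v) (mN _ _ vi)).
  by rewrite cardsE -(size_map (inord : nat -> 'I_6) l) card_size.
have vi i : adj (inc_vertex i) (other_end i) by have [] := incidenceE i.
have iv i : adj (other_end i) (inc_vertex i) by rewrite adj_sym.
move=> x y xy [p [+ + +]].
suff h : path adj x p -> last x p = y -> size p <= 3 -> c x != c y.
  move=> h1 h2 h3; apply: contra (h h1 h2 h3) => /eqP E; apply/eqP.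
  by rewrite -[c x](@inordK 5) // E inordK.
case: p => [|m1 [|m2 [|m3 [|]]]] //=.
- by move=> _ E; rewrite E eqxx in xy.
- rewrite andbT => h E _; subst m1; move: x y xy h => [v|i] [w|j] // _.
  + by move=> /eqP <-; apply: F1.
  + by move=> /eqP <-; rewrite eq_sym; apply: F1.
  + by move/third_adj_inc => /= [-> ->]; apply: F5.
- rewrite andbT => /andP[h1 h2] E _; subst m2.
  move: x m1 y xy h1 h2 => [v|i] [u|k] [w|j] // xy.
  + by move=> /eqP E1 /eqP E2; rewrite -E1 -E2 eqxx in xy.
  + by move=> /eqP <- /third_adj_inc /= [-> ->]; apply: F2.
  + move=> /eqP <- /eqP /= E; rewrite E; apply: F4; rewrite ?vi //.
      by rewrite -E.
    by apply: contra xy => /eqP o; rewrite (inc_inj (esym E) o).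
  + move=> /third_adj_inc[E _] /eqP <-; rewrite eq_sym /= E; exact: F2.
  + move=> /third_adj_inc[E1 E2] /third_adj_inc[E3 E4].
    by case/eqP: xy; congr inr; apply: inc_inj; rewrite ?E3 ?E4 ?E1 ?E2.
- rewrite andbT => /and3P[h1 h2 h3] E _; subst m3.
  move: x m1 m2 y xy h1 h2 h3 => [v|i] [u|k] [t|l] [w|j] // xy.
  + by move=> /eqP <- /eqP -> /eqP <-; apply: F1.
  + by move=> /eqP <- /third_adj_inc[E _] /eqP <- /=; rewrite E; apply: F3.
  + move=> /eqP <- /third_adj_inc[E1 E2] /third_adj_inc[/= -> ->].
    by rewrite E1 E2; apply: F1.
  + by move=> /eqP <- /eqP E /eqP <-; rewrite eq_sym /= E; apply: F1.
  + move=> /eqP <- /eqP E /third_adj_inc[/= -> ->]; rewrite E.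
    by apply: F5; rewrite ?vi // -E.
  + move=> /third_adj_inc[E1 E2] /eqP <- /eqP /= E; rewrite eq_sym E E1.
    by apply: F5; rewrite ?iv // -E1 -E.
  + move=> /third_adj_inc[E1 E2] /third_adj_inc[E3 E4] /eqP <- /=.
    by rewrite E3 E2 eq_sym; apply: F1.
  + move=> /third_adj_inc[E1 E2] /third_adj_inc[E3 E4] /third_adj_inc[/= -> ->].
    by rewrite E3 E4 E1 E2; apply: F5.
Qed.

Lemma chi_le6 : chi_vi G 2 isT <= 6.
Proof.
rewrite /chi_vi; case: ex_minnP => m _; apply; apply/boolp.asboolP.
have [cv [ca col]] := coloring_exists [set: G]; exact: colored_ks col.
Qed.
End Colorable.

(** * Crossing numbers of chains *)

From mathcomp Require Import all_boot all_order all_algebra.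
From mathcomp Require Import all_classical all_reals all_analysis.
From mathcomp Require Import lra.

Import Order.TTheory GRing.Theory Num.Theory.
Import numFieldNormedType.Exports.

Section Chains.
Local Open Scope ring_scope.
Variable R : realType.
Local Notation point := (R * R)%type.
Implicit Types (u v x y c d : point) (s t : seq point).

Definition close_pts (e : R) u v :=
  (`|u.1 - v.1| < e) && (`|u.2 - v.2| < e).

(* The half-open quadrants are numbered counterclockwise; quad 0 = 3 is junk. *)
Definition quad u : nat :=
  if 0 < u.1 then if 0 <= u.2 then 0%N else 3%N
  else if 0 < u.2 then 1%N
  else if u.1 < 0 then 2%N else 3%N.

(** With half-open quadrants exactly one of [u] and [- u] is lower when [u] is nonzero, even on the
    axes. *)
Definition lower u : int := (1 < quad u)%N.

(** Passing from quadrant 3 to 0 crosses the positive first axis upwards. A jump between opposite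
    quadrants gets the meaningless value 0; [quad_close] excludes it. *)
Definition carry (p q : nat) : int :=
  if (p == 3)%N && (q == 0)%N then 1
  else if (p == 0)%N && (q == 3)%N then -1 else 0.

Definition opposite (p q : nat) := (p == q + 2)%N || (q == p + 2)%N.

Lemma quad_lt4 u : (quad u < 4)%N.
Proof. by rewrite /quad; do !case: ifP. Qed.

Lemma quad_opp u : u != 0 ->
  quad (- u) = (if (1 < quad u)%N then quad u - 2 else quad u + 2)%N.
Proof.
case: u => a b nz; have nz2 : a = 0 -> b = 0 -> False.
  by move=> a0 b0; rewrite a0 b0 eqxx in nz.
rewrite /quad /= !oppr_gt0 !oppr_lt0 oppr_ge0.
by case: (ltgtP 0 a) nz2 => ha; case: (ltgtP 0 b) => hb // /(_ (esym ha) (esym hb)).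
Qed.

Lemma quadE u : match quad u with
  | 0 => 0 < u.1 /\ 0 <= u.2 | 1 => u.1 <= 0 /\ 0 < u.2
  | 2 => u.1 < 0 /\ u.2 <= 0 | _ => 0 <= u.1 /\ u.2 <= 0 end.
Proof.
rewrite /quad; case: (ltP 0 u.1) => ha; case: (leP 0 u.2) => hb //.
- by split; apply: ltW.
- case: (ltP 0 u.2) => // hb2; case: (ltP u.1 0) => //.
- by rewrite (lt_gtF hb); case: ltP => ? //; split=> //; exact: ltW.
Qed.

(** Some coordinate of [u] has absolute value at least [e], so [v] keeps its strict sign there,
    whereas opposite quadrants disagree in both signs. *)
Lemma quad_close e u v :
  ~~ close_pts e u 0 -> close_pts e u v -> ~~ opposite (quad u) (quad v).
Proof.
rewrite /close_pts /opposite !subr0 negb_and -!leNgt => far /andP[].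
rewrite !ltr_norml => /andP[h1 h2] /andP[h3 h4].
have {}far : [\/ e <= u.1, e <= - u.1, e <= u.2 | e <= - u.2].
  by move: far; rewrite !ler_normr => /orP[] /orP[] h;
    [constructor 1|constructor 2|constructor 3|constructor 4].
move: (quadE u) (quadE v) (quad_lt4 u) (quad_lt4 v).
case: (quad u) => [|[|[|[|]]]] //; case: (quad v) => [|[|[|[|]]]] // [? ?] [? ?] _ _;
  by case: far; lra.
Qed.

(** Pairwise non-opposite quadrants are at most two adjacent ones, so the corners of a small square
    cannot wind around the origin. *)
Lemma carry_cell (p q r s : nat) :
  (p < 4)%N -> (q < 4)%N -> (r < 4)%N -> (s < 4)%N ->
  ~~ opposite p q -> ~~ opposite p r -> ~~ opposite p s ->
  ~~ opposite q r -> ~~ opposite q s -> ~~ opposite r s ->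
  carry p q + carry q s = carry p r + carry r s.
Proof.
by case: p => [|[|[|[|]]]] //; case: q => [|[|[|[|]]]] //;
  case: r => [|[|[|[|]]]] //; case: s => [|[|[|[|]]]].
Qed.

(** The left side counts crossings of the negative first axis; a step changes between the upper and
    lower half exactly when it crosses one of the two half-axes. *)
Lemma carry_opp u v : u != 0 -> v != 0 -> ~~ opposite (quad u) (quad v) ->
  carry (quad (- u)) (quad (- v)) =
  carry (quad u) (quad v) + lower v - lower u.
Proof.
move=> nu nv; rewrite /lower !quad_opp //.
move: (quad_lt4 u) (quad_lt4 v).
by case: (quad u) => [|[|[|[|]]]] //; case: (quad v) => [|[|[|[|]]]].
Qed.

Lemma lower_opp u : u != 0 -> lower (- u) = 1 - lower u.
Proof.
move=> nu; rewrite /lower !quad_opp //.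
by move: (quad_lt4 u); case: (quad u) => [|[|[|[|]]]].
Qed.

(* The signed number of times the chain x, s crosses the ray going from c in
   the direction of the positive first axis. *)
Fixpoint crossings c x s : int :=
  if s is y :: s' then
    carry (quad (x - c)) (quad (y - c)) + crossings c y s'
  else 0.

Lemma close_ptsC e u v : close_pts e u v = close_pts e v u.
Proof. by rewrite /close_pts distrC [`|u.2 - _|]distrC. Qed.

Lemma close_ptsB e u v x y :
  close_pts e u x -> close_pts e v y -> close_pts (e + e) (u - v) (x - y).
Proof.
rewrite /close_pts /= !ltr_norml => /andP[/andP[? ?] /andP[? ?]].
by move=> /andP[/andP[? ?] /andP[? ?]]; apply/andP; split; apply/andP; split; lra.
Qed.

Lemma far_sub e u v : ~~ close_pts e u v -> ~~ close_pts e (u - v) 0.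
Proof. by rewrite /close_pts /= !subr0. Qed.

Lemma close_pts_refl e u : 0 < e -> close_pts e u u.
Proof. by move=> e0; rewrite /close_pts !subrr normr0 e0. Qed.

Lemma far_neq e u v : 0 < e -> ~~ close_pts e u v -> u - v != 0.
Proof.
by move=> e0; apply: contra; rewrite subr_eq0 => /eqP->; apply: close_pts_refl.
Qed.

Section Square.
Variable e : R.
Hypothesis e0 : 0 < e.

Definition far_chains s t := all (fun x => all (fun y => ~~ close_pts (e + e) x y) t) s.

Lemma far_chainsP s t :
  reflect {in s & t, forall x y, ~~ close_pts (e + e) x y} (far_chains s t).
Proof.
apply: (iffP allP) => [h x y xs yt|h x xs]; first exact: (allP (h x xs)).
by apply/allP => y; apply: h.
Qed.

Lemma opposite_far x y c d : close_pts e x y -> close_pts e c d ->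
  ~~ close_pts (e + e) x c -> ~~ opposite (quad (x - c)) (quad (y - d)).
Proof.
move=> xy cd /far_sub f; apply: quad_close f _; exact: close_ptsB.
Qed.

(** Moves the origin of the ray from [c] to [d] under a fixed chain, with one [carry_cell] per step
    of the chain. *)
Lemma crossings_strip c d x s :
  path (close_pts e) x s -> close_pts e c d -> far_chains (x :: s) [:: c; d] ->
  crossings c x s + carry (quad (last x s - c)) (quad (last x s - d)) =
  carry (quad (x - c)) (quad (x - d)) + crossings d x s.
Proof.
elim: s x => [|y s IH] x /=; first by rewrite add0r addr0.
move=> /andP[xy ps] cd /andP[fx fs]; rewrite -addrA IH //.
rewrite !addrA; congr (_ + _).
move: fx fs => /and3P[xc xd _] /andP[/and3P[yc yd _] _].
have r := fun x => close_pts_refl x e0.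
have [yx dc] : close_pts e y x /\ close_pts e d c.
  by rewrite !(close_ptsC e _ x) (close_ptsC e d).
by apply: carry_cell; rewrite ?quad_lt4 //; apply: opposite_far.
Qed.

(** Strips are stacked along the second chain. By [carry_opp] the carries left at [a] and [b] become
    crossings of the second chain with the rays from there, and the [lower] terms telescope. *)
Lemma crossings_square a s c t :
  path (close_pts e) a s -> path (close_pts e) c t -> far_chains (a :: s) (c :: t) ->
  let b := last a s in let d := last c t in
  crossings c a s + crossings b c t + lower (d - b) - lower (c - b) =
  crossings d a s + crossings a c t + lower (d - a) - lower (c - a).
Proof.
move=> ps; elim: t c => [|y t IH] c; first by rewrite /= !addr0 => *; lia.
move=> /andP[cy pt] /far_chainsP f /=.
have fIH : far_chains (a :: s) (y :: t).
  by apply/far_chainsP => x z xs zt; apply: f; rewrite // inE zt orbT.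
have {IH} := IH _ pt fIH.
have fst : far_chains (a :: s) [:: c; y].
  apply/far_chainsP => x z xs; rewrite !inE => /orP[]/eqP->;
    by apply: f => //; rewrite !inE eqxx ?orbT.
have := crossings_strip ps cy fst.
have cr x : x \in a :: s -> carry (quad (x - c)) (quad (x - y)) =
    carry (quad (c - x)) (quad (y - x)) + lower (y - x) - lower (c - x).
  move=> xs; rewrite -(opprB c) -(opprB y).
  have ee : 0 < e + e by rewrite addr_gt0.
  have xc : ~~ close_pts (e + e) c x by rewrite close_ptsC f // inE eqxx.
  have xy : ~~ close_pts (e + e) y x by rewrite close_ptsC f // !inE eqxx orbT.
  rewrite carry_opp //; [exact: far_neq xc|exact: far_neq xy|].
  by apply: opposite_far; rewrite ?close_pts_refl.
rewrite !cr ?mem_last ?mem_head //.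
set d := last y t; set b := last a s; lia.
Qed.

End Square.
End Chains.

(** * Nonplanarity of K3,3 and K5 by parity *)

Section Nonplanar.
Local Open Scope ring_scope.
Variables (R : realType) (e : R).
Hypothesis e0 : 0 < e.
Local Notation point := (R * R)%type.

Definition chain (x y : point) (s : seq point) :=
  path (close_pts e) x s /\ last x s = y.

(** In the sum of the 18 relations each crossing number occurs an even number of times, and so does
    each [lower] term except those between two points [B]. By [anti] these give 1 for each pair of
    [A] and pair of [B], nine in all, which is odd. *)
Lemma no_K33_chains (A B : nat -> point) (E : nat -> nat -> seq point) :
  (forall i j, (i < 3)%N -> (j < 3)%N -> chain (A i) (B j) (E i j)) ->
  (forall i j k l, [&& i < k, k < 3, j < 3, l < 3 & j != l]%N ->
     far_chains e (A i :: E i j) (A k :: E k l)) ->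
  False.
Proof.
move=> ch far.
pose p i j k := crossings (A k) (A i) (E i j).
pose q i j l := crossings (B l) (A i) (E i j).
have eqn i j k l : [&& i < k, k < 3, j < 3, l < 3 & j != l]%N ->
    p i j k + q k l j + lower (B l - B j) - lower (A k - B j) =
    q i j l + p k l i + lower (B l - A i) - lower (A k - A i).
  move=> ijkl; have [i3 k3 j3 l3] : [/\ i < 3, k < 3, j < 3 & l < 3]%N.
    by split; lia.
  have [pi li] := ch i j i3 j3; have [pk lk] := ch k l k3 l3.
  by have := crossings_square e0 pi pk (far _ _ _ _ ijkl); rewrite /= li lk.
have anti j l : (j < l < 3)%N -> lower (B j - B l) = 1 - lower (B l - B j).
  move=> jl; rewrite -(opprB (B l)) lower_opp //.
  have [j3 l3] : (j < 3)%N /\ (l < 3)%N by lia.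
  have jl' : [&& 0 < 1, 1 < 3, l < 3, j < 3 & l != j]%N by lia.
  have := far _ _ _ _ jl'.
  have [_ <-] := ch 0%N l isT l3; have [_ <-] := ch 1%N j isT j3.
  move=> /far_chainsP /(_ _ _ (mem_last _ _) (mem_last _ _)); apply: far_neq.
  by rewrite addr_gt0.
have a01 := anti 0%N 1%N isT; have a02 := anti 0%N 2%N isT.
have a12 := anti 1%N 2%N isT.
have E01 j l jl := eqn 0%N j 1%N l jl; have E02 j l jl := eqn 0%N j 2%N l jl.
have E12 j l jl := eqn 1%N j 2%N l jl.
move: (E01 0 1 isT)%N (E01 0 2 isT)%N (E01 1 2 isT)%N.
move: (E01 1 0 isT)%N (E01 2 0 isT)%N (E01 2 1 isT)%N.
move: (E02 0 1 isT)%N (E02 0 2 isT)%N (E02 1 2 isT)%N.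
move: (E02 1 0 isT)%N (E02 2 0 isT)%N (E02 2 1 isT)%N.
move: (E12 0 1 isT)%N (E12 0 2 isT)%N (E12 1 2 isT)%N.
move: (E12 1 0 isT)%N (E12 2 0 isT)%N (E12 2 1 isT)%N.
rewrite a01 a02 a12; clear.
lia.
Qed.

(** There are 15 relations, one per pair of independent edges. Each crossing number occurs twice and
    each pair of points six times. Every four points contribute three differences in reversed order,
    which [anti] turns around at the cost of 1 each: 15 in all, which is odd. *)
Lemma no_K5_chains (P : nat -> point) (E : nat -> nat -> seq point) :
  (forall i j, (i < j < 5)%N -> chain (P i) (P j) (E i j)) ->
  (forall i j k l, [&& i < j, j < 5, k < l, l < 5, i < k, j != k & j != l]%N ->
     far_chains e (P i :: E i j) (P k :: E k l)) ->
  False.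
Proof.
move=> ch far.
pose p i j k := crossings (P k) (P i) (E i j).
have eqn i j k l : [&& i < j, j < 5, k < l, l < 5, i < k, j != k & j != l]%N ->
    p i j k + p k l j + lower (P l - P j) - lower (P k - P j) =
    p i j l + p k l i + lower (P l - P i) - lower (P k - P i).
  move=> ijkl; have [ij kl] : (i < j < 5)%N /\ (k < l < 5)%N by lia.
  have [pi li] := ch i j ij; have [pk lk] := ch k l kl.
  by have := crossings_square e0 pi pk (far _ _ _ _ ijkl); rewrite /= li lk.
have anti j k : (0 < j < k)%N -> (k < 5)%N ->
    lower (P j - P k) = 1 - lower (P k - P j).
  move=> jk k5; rewrite -(opprB (P k)) lower_opp //.
  (* [P j] and [P k] differ because they are ends of independent edges: one from 0 to [k], the other
     from [j] to a further index [l]. *)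
  have [a [b [ab abj]]] : exists a b, 
      [&& 0 < k, k < 5, a < b, b < 5, 0 < a, k != a & k != b]%N /\
      (a = j \/ b = j).
    have [l [l1 l2]] : exists l, (0 < l < 5)%N /\ (l <> j /\ l <> k).
      have [lj|lj] := eqVneq j 1%N; last by exists 1%N; lia.
      have [lk|lk] := eqVneq k 2%N; last by exists 2%N; lia.
      by exists 3%N; lia.
    have [h|h] := ltnP l j; first by exists l, j; split; lia.
    by exists j, l; split; lia.
  have [k5' b5] : (0 < k < 5)%N /\ (a < b < 5)%N by lia.
  have := far _ _ _ _ ab.
  have [_ lk] := ch 0%N k k5'; have [_ lb] := ch a b b5.
  move=> /far_chainsP /(_ (P k) (P j)); rewrite -{1}lk mem_last => /(_ isT) h.
  apply: (far_neq (addr_gt0 e0 e0)); apply: h.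
  by case: abj => <-; rewrite ?mem_head // -lb mem_last.
move: (eqn 0 1 2 3 isT)%N (eqn 0 1 2 4 isT)%N (eqn 0 1 3 4 isT)%N.
move: (eqn 0 2 1 3 isT)%N (eqn 0 2 1 4 isT)%N (eqn 0 2 3 4 isT)%N.
move: (eqn 0 3 1 2 isT)%N (eqn 0 3 1 4 isT)%N (eqn 0 3 2 4 isT)%N.
move: (eqn 0 4 1 2 isT)%N (eqn 0 4 1 3 isT)%N (eqn 0 4 2 3 isT)%N.
move: (eqn 1 2 3 4 isT)%N (eqn 1 3 2 4 isT)%N (eqn 1 4 2 3 isT)%N.
rewrite (anti 1 2 isT isT)%N (anti 1 3 isT isT)%N (anti 1 4 isT isT)%N.
rewrite (anti 2 3 isT isT)%N (anti 2 4 isT isT)%N (anti 3 4 isT isT)%N; clear.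
lia.
Qed.
End Nonplanar.

(** * Drawings *)

Section PlaneSets.
Local Open Scope ring_scope.
Local Open Scope classical_set_scope.
Variable R : realType.
Local Notation point := (R * R)%type.
Implicit Types (x y p q : point) (A : set point).

Lemma ball_close_pts e x y : ball x e y <-> close_pts e x y.
Proof. by split=> [[h1 h2]|/andP[h1 h2]]; [apply/andP|]. Qed.

Lemma close_pts_le d e x y : d <= e -> close_pts d x y -> close_pts e x y.
Proof. by move=> de /andP[h1 h2]; rewrite /close_pts !(lt_le_trans _ de). Qed.

Lemma close_pts_add d e x y p :
  close_pts d x y -> close_pts e y p -> close_pts (d + e) x p.
Proof.
rewrite /close_pts !ltr_norml => /andP[/andP[? ?] /andP[? ?]].
by move=> /andP[/andP[? ?] /andP[? ?]]; apply/andP; split; apply/andP; split; lra.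
Qed.

(** The points of [A] where [P] holds and those where it fails are both relatively open; [C]
    provides the open sets as unions of balls. *)
Lemma connected_locally_constant A (P : point -> Prop) x :
  connected A -> A x -> P x ->
  (forall y, A y -> exists2 d, 0 < d &
     forall p, A p -> close_pts d y p -> (P y <-> P p)) ->
  forall y, A y -> P y.
Proof.
move=> cA Ax Px loc.
pose C (Q : point -> Prop) := \bigcup_(yd in [set yd : point * R | [/\ A yd.1, Q yd.1 &
  forall p, A p -> close_pts yd.2 yd.1 p -> Q p]]) ball yd.1 yd.2.
have oC Q : open (C Q) by apply: bigcup_open => -[y d] _; exact: ball_open.
have CQ Q y : A y -> C Q y -> Q y.
  by move=> Ay [[p d] [/= Ap Qp h] /ball_close_pts py]; apply: h.
suff E : A `&` P = A by move=> y; rewrite -E => -[].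
apply: cA; first by exists x.
- exists (C P) => //; apply/seteqP; split=> y [Ay Py]; split=> //; last exact: CQ Py.
  have [d d0 h] := loc y Ay; exists (y, d); last by apply: ballxx.
  by split=> //= p Ap yp; apply/(h p Ap yp).
- exists (~` C (fun y => ~ P y)); first exact: open_closedC.
  apply/seteqP; split=> y [Ay]; first by move=> Py; split=> // /CQ; apply.
  move=> nC; split=> //; apply: contrapT => nP; apply: nC.
  have [d d0 h] := loc y Ay; exists (y, d); last by apply: ballxx.
  by split=> //= p Ap yp /(h p Ap yp).
Qed.

Definition chain_in e (Q : point -> Prop) x y :=
  exists s, chain e x y s /\ (forall p, p \in x :: s -> Q p).

Lemma chain_in_refl e (Q : point -> Prop) x : Q x -> chain_in e Q x x.
Proof. by move=> Qx; exists [::]; split=> // p; rewrite inE => /eqP->. Qed.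

Lemma chain_in_step e (Q : point -> Prop) x y :
  Q x -> Q y -> close_pts e x y -> chain_in e Q x y.
Proof.
move=> Qx Qy xy; exists [:: y]; split; first by split; rewrite //= xy.
by move=> p; rewrite !inE => /orP[]/eqP->.
Qed.

Lemma chain_in_trans e Q x y p :
  chain_in e Q x y -> chain_in e Q y p -> chain_in e Q x p.
Proof.
move=> [s [[ps ls] qs]] [t [[pt lt] qt]]; exists (s ++ t); split.
  by split; rewrite ?cat_path ?last_cat ls ?ps.
move=> q; rewrite inE mem_cat => /or3P[/eqP->|qsm|qtm].
- by apply: qs; rewrite mem_head.
- by apply: qs; rewrite inE qsm orbT.
- by apply: qt; rewrite inE qtm orbT.
Qed.

Lemma chain_in_sym e Q x y : chain_in e Q x y -> chain_in e Q y x.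
Proof.
move=> [s [[ps <-] qs]]; exists (rev (belast x s)); split.
  split; last by case: s {ps qs} => //= a s; rewrite rev_cons last_rcons.
  by rewrite rev_path; under eq_path do rewrite close_ptsC.
move=> p; rewrite inE mem_rev => /orP[/eqP->|]; first by apply/qs/mem_last.
by move=> /mem_belast; apply: qs.
Qed.

Lemma chain_in_sub e (Q Q' : point -> Prop) x y :
  (forall p, Q p -> Q' p) -> chain_in e Q x y -> chain_in e Q' x y.
Proof. by move=> QQ [s [c qs]]; exists s; split=> // p /qs /QQ. Qed.

Lemma connected_chain_in A e x y : 0 < e -> connected A -> A x -> A y ->
  chain_in e A x y.
Proof.
move=> e0 cA Ax; apply: (connected_locally_constant cA Ax).
  exact: chain_in_refl.
move=> p Ap; exists e => // q Aq pq; have h := chain_in_step Ap Aq pq.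
split=> c; first by apply: chain_in_trans c h.
by apply: chain_in_trans c _; apply: chain_in_sym.
Qed.

Lemma segment_chain_in r e x y : 0 < e -> close_pts r x y ->
  chain_in e (close_pts r x) x y.
Proof.
move=> e0 xy; pose f (t : R) : point := (x.1 + t * (y.1 - x.1), x.2 + t * (y.2 - x.2)).
have cf : continuous f.
  have h (a b t : R) : (a + z * b) @[z --> t] --> a + t * b.
    by apply: cvgD; [exact: cvg_cst|apply: cvgM; [exact: cvg_id|exact: cvg_cst]].
  by move=> t; exact: cvg_pair (h x.1 (y.1 - x.1) t) (h x.2 (y.2 - x.2) t).
have cA : connected (f @` `[0, 1]).
  apply: connected_continuous_connected; first exact: segment_connected.
  exact: continuous_subspaceT.
have Ax : (f @` `[0, 1]) x.
  exists 0; first by rewrite /= in_itv /= lexx ler01.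
  by rewrite /f !mul0r !addr0; case: (x).
have Ay : (f @` `[0, 1]) y.
  exists 1; first by rewrite /= in_itv /= lexx ler01.
  by rewrite /f !mul1r ![_ + (_ - _)]addrC !subrK; case: (y).
apply: chain_in_sub (connected_chain_in e0 cA Ax Ay) => p [t].
rewrite /= in_itv /= => /andP[t0 t1] <-; move: xy.
rewrite /close_pts /f /= !opprD !addrA !subrr !sub0r !normrN !normrM (ger0_norm t0).
rewrite (distrC x.1) (distrC x.2) => /andP[h1 h2].
by rewrite (le_lt_trans _ h1) ?(le_lt_trans _ h2) ?ler_piMl.
Qed.

(** Near each point of [A] every small [d] works because [B] is closed; compactness of [A] makes the
    choice uniform. *)
Lemma compact_separated A B : compact A -> compact B -> A `&` B = set0 ->
  exists2 d, 0 < d & forall x y, A x -> B y -> ~~ close_pts d x y.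
Proof.
move=> cA cB AB.
have clB : closed B by apply: compact_closed => //; exact: norm_hausdorff.
have /compact_near_coveringP cov := cA.
have : \forall d \near (0:R)^'+, forall x, A x -> forall y, B y -> ~~ close_pts d x y.
  apply: cov => x Ax.
  have : nbhs x (~` B).
    apply: open_nbhs_nbhs; split; first exact: closed_openC.
    by move=> Bx; have : (A `&` B) x by []; rewrite AB.
  move=> /nbhs_ballP[r /= r0 rB].
  have r2 : 0 < r / 2 by rewrite divr_gt0.
  exists (ball x (r/2), [set d | d < r / 2]).
    split; first by apply: nbhsx_ballx.
    by apply: nbhs_right_lt.
  move=> [p d] [/= /ball_close_pts xp dr] y By; apply/negP => py.
  apply: (rB y) => //; apply/ball_close_pts.
  apply: close_pts_le (close_pts_add xp py); lra.
move=> h; near (0:R)^'+ => d; exists d => //.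
by near: d; apply: filterS h => d h x y Ax By; apply: h.
Unshelve. all: by end_near.
Qed.

Lemma finite_min (I : finType) (P : I -> R -> Prop) :
  (forall i d e, d <= e -> P i e -> P i d) ->
  (forall i, exists2 d, 0 < d & P i d) ->
  exists2 d, 0 < d & forall i, P i d.
Proof.
move=> mono ex.
have /choice[f hf] : forall i, exists d, 0 < d /\ P i d.
  by move=> i; have [d d0 Pd] := ex i; exists d.
exists (\big[Order.min/1]_i f i).
  by apply: lt_bigmin => [|i _]; [exact: ltr01|have [] := hf i].
by move=> i; apply: mono (proj2 (hf i)); apply: bigmin_le.
Qed.
End PlaneSets.

(** * Vertices and edges as cells, and the cone point *)

Section Cells.
Local Open Scope ring_scope.
Local Open Scope classical_set_scope.
Variables (R : realType) (G : sgraph).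
Local Notation point := (R * R)%type.
Variables (pos : G -> point) (curve : {set G} -> set point).
Hypothesis drawn : plane_drawing pos curve.

(** A pair [(v, v)] stands for a vertex and [(u, v)] for an edge, so that points and curves are
    handled together. *)
Definition cell_index (a : G * G) := (a.1 == a.2) || adj a.1 a.2.
Definition cell (a : G * G) : set point :=
  if a.1 == a.2 then [set pos a.1] else curve [set a.1; a.2]%SET.
Definition avoids (v : G) (a : G * G) := (v != a.1) && (v != a.2).

Lemma adj_edge (u v : G) : adj u v -> [set u; v]%SET \in edges G.
Proof.
move=> uv; rewrite inE; apply/existsP; exists u; apply/existsP; exists v.
by rewrite uv eqxx.
Qed.

Lemma cell_adj (u v : G) : adj u v -> cell (u, v) = curve [set u; v]%SET.
Proof. by rewrite /cell /=; case: eqP => // ->; rewrite adj_irr. Qed.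

Lemma cell_ends a : cell_index a -> cell a (pos a.1) /\ cell a (pos a.2).
Proof.
case: a => u v; rewrite /cell_index /=; case: eqVneq => [<- _|uv /= uv'].
  by rewrite /cell /= eqxx.
rewrite cell_adj //; have [_ /(_ _ _ uv')[g [_ _ g0 g1 ->]] _ _] := drawn.
by split; [exists 0|exists 1]; rewrite //= in_itv /= lexx ler01.
Qed.

Lemma cell_compact a : cell_index a -> compact (cell a).
Proof.
case: a => u v; rewrite /cell_index /=; case: eqVneq => [<- _|uv /= uv'].
  by rewrite /cell /= eqxx; exact: compact_set1.
rewrite cell_adj //; have [_ /(_ _ _ uv')[g [cg _ _ _ ->]] _ _] := drawn.
by apply: continuous_compact => //; exact: segment_compact.
Qed.

Lemma cell_chain u v e : 0 < e -> adj u v ->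
  chain_in e (cell (u, v)) (pos u) (pos v).
Proof.
move=> e0 uv; have iuv : cell_index (u, v) by rewrite /cell_index uv orbT.
have [h1 h2] := cell_ends iuv; apply: connected_chain_in => //.
rewrite cell_adj //; have [_ /(_ _ _ uv)[g [cg _ _ _ ->]] _ _] := drawn.
by apply: connected_continuous_connected => //; exact: segment_connected.
Qed.

Lemma cell_disjoint a b : cell_index a -> cell_index b ->
  avoids a.1 b -> avoids a.2 b -> cell a `&` cell b = set0.
Proof.
case: drawn => injp _ pin disj.
have point_curve u b1 b2 : adj b1 b2 -> avoids u (b1, b2) ->
    ~ cell (b1, b2) (pos u).
  move=> ab /andP[/= n1 n2]; rewrite cell_adj // => /(pin _ _ (adj_edge ab)).
  by rewrite !inE (negPf n1) (negPf n2).
case: a b => [a1 a2] [b1 b2]; rewrite /cell_index /=.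
have [-> _|na /= aa] := eqVneq a1 a2; have [-> _|nb /= bb] := eqVneq b1 b2.
- move=> /andP[/= nab _] _; rewrite /cell /= !eqxx.
  by apply/seteqP; split=> // x [/= -> /injp h]; rewrite h eqxx in nab.
- move=> h _; apply/seteqP; split=> // x []; rewrite {1}/cell /= eqxx /= => ->.
  exact: point_curve.
- move=> /andP[/= h1 _] /andP[/= h2 _].
  apply/seteqP; split=> // x [+ h]; move: h; rewrite {1}/cell /= eqxx /= => ->.
  by apply: point_curve; rewrite // /avoids /= eq_sym h1 eq_sym h2.
- move=> /andP[/= h1 h2] /andP[/= h3 h4]; rewrite !cell_adj //.
  apply/seteqP; split=> // x h.
  have ne : [set a1; a2]%SET != [set b1; b2]%SET :> {set G}.
    apply/eqP => /setP /(_ a1); rewrite !inE eqxx.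
    by rewrite (negPf h1) (negPf h2).
  have [w [/=]] := disj _ _ (adj_edge aa) (adj_edge bb) ne x h.
  rewrite !inE => /orP[]/eqP->; rewrite ?(negPf h1) ?(negPf h2) ?(negPf h3) ?(negPf h4) //.
Qed.

Lemma cells_separated : exists2 d, 0 < d & forall a b,
  cell_index a -> cell_index b -> avoids a.1 b -> avoids a.2 b ->
  forall x y, cell a x -> cell b y -> ~~ close_pts d x y.
Proof.
have := @finite_min R ((G * G) * (G * G))%type (fun ab d =>
  cell_index ab.1 -> cell_index ab.2 -> avoids ab.1.1 ab.2 -> avoids ab.1.2 ab.2 ->
  forall x y, cell ab.1 x -> cell ab.2 y -> ~~ close_pts d x y).
case.
- move=> ab d e de h i1 i2 v1 v2 x y ax bx.
  by apply: contra (h i1 i2 v1 v2 x y ax bx); apply: close_pts_le.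
- move=> [a b] /=; have [/and4P[i1 i2 v1 v2]|n] :=
    boolP [&& cell_index a, cell_index b, avoids a.1 b & avoids a.2 b].
    have [d d0 h] := compact_separated (cell_compact i1) (cell_compact i2)
      (cell_disjoint i1 i2 v1 v2).
    by exists d.
  by exists 1 => // i1 i2 v1 v2; rewrite i1 i2 v1 v2 in n.
- by move=> d d0 h; exists d => // a b; exact: (h (a, b)).
Qed.

Definition clear (r : R) (I : pred (G * G)) (p : point) :=
  forall a q, cell_index a -> I a -> cell a q -> ~~ close_pts r p q.

Lemma clear_le r r' I p : r <= r' -> clear r' I p -> clear r I p.
Proof.
by move=> rr h a q ia Ia aq; apply: contra (h a q ia Ia aq); apply: close_pts_le.
Qed.

Lemma clear_exists (I : pred (G * G)) p :
  (forall a, cell_index a -> I a -> ~ cell a p) ->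
  exists2 r, 0 < r & clear r I p.
Proof.
move=> h; have := @finite_min R (G * G)%type (fun a r => cell_index a -> I a ->
  forall q, cell a q -> ~~ close_pts r p q).
case.
- move=> a d e de h' i1 i2 q aq.
  by apply: contra (h' i1 i2 q aq); apply: close_pts_le.
- move=> a; have [/andP[ia Ia]|n] := boolP (cell_index a && I a).
    have [|d d0 hd] := compact_separated (@compact_set1 _ p) (cell_compact ia).
      by apply/seteqP; split=> // x [/= ->]; exact: h.
    by exists d => // _ _ q aq; apply: hd.
  by exists 1; [exact: ltr01|move=> i1 i2; rewrite i1 i2 in n].
- by move=> r r0 hr; exists r => // a q ia Ia; exact: (hr a ia Ia).
Qed.

Lemma clear_ball r I p q : clear (r + r) I p -> close_pts r p q -> clear r I q.
Proof.
move=> cp pq a x ia Ia ax; apply: contra (cp a x ia Ia ax).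
exact: close_pts_add.
Qed.

(** The clearance [r] is fixed before the mesh [e], so that [e] can later be taken small compared
    with [r]. *)
Definition joined (I : pred (G * G)) p q := exists2 r, 0 < r &
  forall e, 0 < e -> chain_in e (clear r I) p q.

Lemma joined_sym I p q : joined I p q -> joined I q p.
Proof. by move=> [r r0 h]; exists r => // e e0; apply/chain_in_sym/h. Qed.

Lemma joined_trans I p q x : joined I p q -> joined I q x -> joined I p x.
Proof.
move=> [r r0 h] [r' r0' h']; exists (Order.min r r').
  by rewrite lt_min r0.
move=> e e0; apply: chain_in_trans (chain_in_sub _ (h e e0)) (chain_in_sub _ (h' e e0)).
  by move=> y; apply: clear_le; rewrite ge_min lexx.
by move=> y; apply: clear_le; rewrite ge_min lexx orbT.
Qed.

Lemma joined_near (I : pred (G * G)) p : (forall a, cell_index a -> I a -> ~ cell a p) ->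
  exists2 r, 0 < r & forall q, close_pts r p q -> joined I p q.
Proof.
move=> /clear_exists[r r0 cr]; have r2 : 0 < r / 2 by rewrite divr_gt0.
exists (r / 2) => // q pq; exists (r / 2) => // e e0.
apply: chain_in_sub (segment_chain_in e0 pq) => y; apply: clear_ball.
by rewrite -splitr.
Qed.

(** Being joined to [z] clear of all cells is locally constant on the face, which is connected. *)
Lemma joined_face z p : let F := connected_component (~` drawing_set pos curve) z in
  F z -> F p -> joined predT z p.
Proof.
move=> F Fz; have out y : F y -> forall a, cell_index a -> predT a -> ~ cell a y.
  move=> /connected_component_sub nD [u v] iuv _ cy; apply: nD.
  move: iuv cy; rewrite /cell_index /=.
  have [->|nuv /= uv] := eqVneq u v; first by rewrite /cell /= eqxx /= => _ ->; left; exists v.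
  by rewrite cell_adj // => cy; right; exists [set u; v]%SET => //=; exact: adj_edge.
apply: (connected_locally_constant (@component_connected _ _ _) Fz).
  have [r r0 h] := joined_near (out z Fz).
  by apply: h; apply: close_pts_refl.
move=> y Fy; have [r r0 h] := joined_near (out y Fy).
exists r => // q Fq yq; split=> j; first exact: joined_trans j (h q yq).
exact: joined_trans j (joined_sym (h q yq)).
Qed.

Lemma joined_sub (I J : pred (G * G)) p q :
  subpred I J -> joined J p q -> joined I p q.
Proof.
move=> IJ [r r0 h]; exists r => // e e0; apply: chain_in_sub (h e e0) => x cx.
by move=> a y ia /IJ; apply: cx.
Qed.

Lemma apex_joined F : outer_face (drawing_set pos curve) F ->
  (forall v, closure F (pos v)) ->
  exists z, forall v, joined (avoids v) z (pos v).
Proof.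
move=> [[z nDz FE] _] clF; exists z => v.
have Fz : F z by rewrite FE; exact: connected_component_refl.
have [|r r0 near_v] := @joined_near (avoids v) (pos v).
  move=> a ia va cav; have iv : cell_index (v, v) by rewrite /cell_index eqxx.
  have := cell_disjoint iv ia va va; apply/eqP/set0P; exists (pos v).
  by split=> //; rewrite /cell /= eqxx.
(* The face has a point [q] in the ball around [pos v] that is free of cells not ending at [v]. *)
have [q [Fq /ball_close_pts /near_v vq]] := clF v (ball (pos v) r) (nbhsx_ballx _ _ r0).
apply: joined_trans (joined_sym vq).
rewrite FE in Fz Fq; exact: (@joined_sub _ predT) (joined_face Fz Fq).
Qed.

End Cells.

(** * Weak K4 and K2,3 in an outerplanar graph *)

Section Obstructions.
Local Open Scope ring_scope.
Local Open Scope classical_set_scope.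
Variables (R : realType) (G : sgraph).
Implicit Types (X : {set G}) (u v : G).

(** [reg X] is the drawing of the subgraph induced on [X], and [clr v] consists of the points with a
    fixed clearance from all cells avoiding [v]. *)
Lemma outerplanar_chains : outerplanar R G ->
  exists (e : R) (pos : G -> R * R) (z : R * R) (reg : {set G} -> set (R * R))
         (clr : G -> set (R * R)),
  [/\ 0 < e,
      forall X u v, joins X u v -> chain_in e (reg X) (pos u) (pos v),
      forall v, chain_in e (clr v) z (pos v),
      forall X (Y : {set G}), [disjoint X & Y]%B -> forall p q, reg X p -> reg Y q ->
        ~~ close_pts (e + e) p q &
      forall X v, v \notin X -> forall p q, reg X p -> clr v q ->
        ~~ close_pts (e + e) q p].
Proof.
move=> [pos [curve [drawn [F oF clF]]]].
have [d d0 sep] := cells_separated drawn.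
have [z zv] := apex_joined drawn oF clF.
have [r r0 hr] := @finite_min R G (fun v r => forall e, 0 < e ->
    chain_in e (clear pos curve r (avoids v)) z (pos v))
  (fun v a b ab h e e0 => chain_in_sub (fun p => clear_le ab) (h e e0)) zv.
(* Halves, because [far_chains] asks for separation [e + e]. *)
pose e := Order.min (d / 2) (r / 2).
have e0 : 0 < e by rewrite lt_min !divr_gt0.
have ed : e + e <= d.
  by rewrite [leRHS]splitr lerD // ge_min lexx.
have er : e + e <= r.
  by rewrite [leRHS]splitr lerD // ge_min lexx orbT.
exists e, pos, z, (fun X p => exists a, [/\ cell_index a, a.1 \in X, a.2 \in X
   & cell pos curve a p]), (fun v => clear pos curve r (avoids v)).
split=> //.
- move=> X u v /andP[uX /connectP[s ps ->]].
  elim: s u uX ps => [|w s IH] u uX /=.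
    move=> _; apply: chain_in_refl; exists (u, u).
    by rewrite /cell_index /cell /= eqxx.
  move=> /andP[/and3P[uw _ wX] /IH{}IH]; apply: chain_in_trans (IH wX).
  apply: chain_in_sub (cell_chain drawn e0 uw) => p cp; exists (u, w).
  by split=> //; rewrite /cell_index uw orbT.
- move=> v; exact: hr.
- move=> X Y XY p q [a [ia a1 a2 ap]] [b [ib b1 b2 bq]].
  have nXY x y : x \in X -> y \in Y -> x != y.
    by move=> xX yY; apply: contraL yY => /eqP <-; rewrite (disjointFr XY).
  have := sep a b ia ib; rewrite /avoids !nXY // => /(_ isT isT _ _ ap bq).
  by apply: contra; apply: close_pts_le.
- move=> X v vX p q [a [ia a1 a2 ap]] /(_ a p ia).
  rewrite /avoids; have nv x : x \in X -> v != x by apply: contraTneq => <-.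
  rewrite !nv // => /(_ isT ap); by apply: contra; apply: close_pts_le.
Qed.

Hypothesis outer : outerplanar R G.

(* Connections sharing an end may meet: only those that correspond to
   independent edges of K4 and K2,3 have to be disjoint. *)
Lemma no_weak_K4 (p : nat -> G) (X : nat -> nat -> {set G}) :
  (forall i j, (i < j < 4)%N -> joins (X i j) (p i) (p j)) ->
  (forall i j k, (i < j < 4)%N -> (k < 4)%N -> k != i -> k != j -> p k \notin X i j) ->
  (forall i j k l, [&& i < j, j < 4, k < l, l < 4, i < k, j != k & j != l]%N ->
     [disjoint X i j & X k l]%B) ->
  False.
Proof.
move=> jX nX dX.
have [e [pos [z [reg [clr [e0 hreg hclr sep sepz]]]]]] := outerplanar_chains outer.
(* The cone point takes index 0 of K5, and the branch vertices of K4 shift by one. *)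
pose P i := if i is i'.+1 then pos (p i') else z.
pose Q i j := if i is i'.+1 then reg (X i' j.-1) else clr (p j.-1).
have /choice[E hE] : forall ij : nat * nat, exists s, (ij.1 < ij.2 < 5)%N ->
    chain e (P ij.1) (P ij.2) s /\ forall q, q \in P ij.1 :: s -> Q ij.1 ij.2 q.
  case=> i [|j] /=; first by exists [::].
  have [ij|nij] := boolP (i < j.+1 < 5)%N; last by exists [::].
  case: i ij => [|i] ij; first by have [s hs] := hclr (p j); exists s.
  by have [|s hs] := hreg _ _ _ (jX i j _); [lia|exists s].
apply: (@no_K5_chains R e e0 P (fun i j => E (i, j))).
  by move=> i j ij; have [] := hE (i, j) ij.
move=> i j k l ijkl; apply/far_chainsP => x y.
have [ij kl] : (i < j < 5)%N /\ (k < l < 5)%N by lia.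
have [_ Qx] := hE (i, j) ij; have [_ Qy] := hE (k, l) kl.
move=> /Qx {}Qx /Qy {}Qy; move: ijkl ij kl Qx Qy {hE}.
case: k l => [|k] [|l]; rewrite ?ltn0 ?andbF //=; case: i j => [|i] [|j] //=.
  by move=> ijkl ij kl Qx Qy; apply: sepz Qy Qx; apply: nX; lia.
by move=> ijkl ij kl; apply: sep; apply: dX; lia.
Qed.

(** The cone point is the third vertex beside [a] and [b] on one side of a K3,3; the [c j] form the
    other side. *)
Lemma no_weak_K23 (a b : G) (c : nat -> G) (X : nat -> {set G}) :
  (forall i, (i < 3)%N -> adj a (c i)) ->
  (forall i, (i < 3)%N -> joins (X i) b (c i)) ->
  (forall i, (i < 3)%N -> a \notin X i) ->
  (forall i j, (i < 3)%N -> (j < 3)%N -> i != j -> c j \notin X i) ->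
  False.
Proof.
move=> ac jX aX cX.
have [e [pos [z [reg [clr [e0 hreg hclr sep sepz]]]]]] := outerplanar_chains outer.
have cc i j : (i < 3)%N -> (j < 3)%N -> i != j -> c i != c j.
  move=> i3 j3 ij; have := cX i j i3 j3 ij; apply: contraNneq => <-.
  have /andP[bX /connectP[s ps ->]] := jX i i3.
  case/lastP: s ps => // s x; rewrite rcons_path last_rcons.
  by move=> /andP[_ /and3P[]].
pose A i := match i with 0 => z | 1 => pos a | _ => pos b end.
pose Q i j := match i with 0 => clr (c j) | 1 => reg [set a; c j]%SET | _ => reg (X j) end.
have /choice[E hE] : forall ij : nat * nat, exists s, (ij.1 < 3)%N -> (ij.2 < 3)%N ->
    chain e (A ij.1) (pos (c ij.2)) s /\ forall q, q \in A ij.1 :: s -> Q ij.1 ij.2 q.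
  case=> i j /=; have [j3|nj] := boolP (j < 3)%N; last by exists [::].
  case: i => [|[|i]].
  - by have [s hs] := hclr (c j); exists s.
  - have [|s hs] := hreg [set a; c j]%SET a (c j) _; last by exists s.
    apply/andP; split; first by rewrite !inE eqxx.
    by apply: connect1; rewrite /inside /= !inE !eqxx ac ?orbT.
  - by have [s hs] := hreg _ _ _ (jX j j3); exists s.
apply: (@no_K33_chains R e e0 A (fun j => pos (c j)) (fun i j => E (i, j))).
  by move=> i j i3 j3; have [] := hE (i, j) i3 j3.
move=> i j k l ijkl; apply/far_chainsP => x y.
have [i3 k3 j3 l3 jl] : [/\ i < 3, k < 3, j < 3, l < 3 & j != l]%N.
  by split; lia.
have [_ Qx] := hE (i, j) i3 j3; have [_ Qy] := hE (k, l) k3 l3.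
move=> /Qx {}Qx /Qy {}Qy; move: ijkl Qx Qy {hE} => /andP[].
case: i i3 => [|[|i]] //= i3; case: k k3 => [|[|[|k]]] //= k3 _ _.
- move=> Qx Qy; apply: sepz Qy Qx; rewrite !inE negb_or (cc j l) // andbT.
  by apply: contraTneq (ac j j3) => ->; rewrite adj_irr.
- by move=> Qx Qy; apply: sepz Qy Qx; apply: cX; rewrite // eq_sym.
- move=> Qx Qy; apply: sep Qx Qy; rewrite disjoint_subset.
  apply/fintype.subsetP => w; rewrite !inE => /orP[]/eqP->; first exact: aX.
  by apply: cX; rewrite // eq_sym.
Qed.
End Obstructions.

Theorem theorem14 (R : realType) (G : sgraph) :
  outerplanar R G -> max_degree G = 3 -> (chi_vi G 2 isT <= 6)%N.
Proof.
move=> outer deg.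
have deg3 (v : G) : (#|neighbours v| <= 3)%N by rewrite -deg; exact: leq_bigmax.
apply: chi_le6 => // S S0 degS.
exact: (reducible_exists deg3 (no_weak_K4 outer) (no_weak_K23 outer)).
Qed.
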